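(* There is no group which can be left-ordered in a countably infinite number of ways. That is, for every group $G$, the set $\mathcal{O}_G$ of all left orders on $G$ is not countably infinite.
   Context: A left order on a group $G$ is a (strict) total order $<$ on the set $G$ which is left invariant: for all $g,x,y \in G$ with $x \ne y$, (i) either $x<y$ or $y<x$, but never both; (ii) if $g<x<y$, then $g<y$; (iii) if $x<y$, then $gx<gy$. The set of all left orders on $G$ is denoted $\mathcal{O}_G$ (it may be empty); two left orders are regarded as different if they differ as relations on $G$. *)

(* Defs.v *)
From mathcomp Require Import all_boot.
From mathcomp Require Import boolp classical_sets functions cardinality.

Set Implicit Arguments.
Unset Strict Implicit.
Unset Printing Implicit Defensive.

Local Open Scope group_scope.

(* Irreflexivity is what makes the order strict: totality only constrains
   distinct elements, so without it each left order would also be counted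
   together with its reflexive closure. *)
Record is_left_order (G : groupType) (lt : G -> G -> Prop) : Prop := {
  left_order_irrefl : forall x, ~ lt x x;
  left_order_total : forall x y, x <> y ->
    (lt x y \/ lt y x) /\ ~ (lt x y /\ lt y x);
  left_order_trans : forall g x y, lt g x -> lt x y -> lt g y;
  left_order_mul : forall g x y, lt x y -> lt (g * x) (g * y)
}.

Definition left_orders (G : groupType) : set (G -> G -> Prop) :=
  [set lt | is_left_order lt]%classic.
Arguments left_orders : clear implicits.

(* Main.v *)
Require Import Defs.
From HB Require Import structures.
From mathcomp Require Import all_boot all_algebra zify.
From mathcomp Require Import boolp classical_sets functions cardinality filter.

Set Implicit Arguments.
Unset Strict Implicit.
Unset Printing Implicit Defensive.

Local Open Scope group_scope.
Local Open Scope classical_set_scope.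

(** A left order is determined by its positive cone, and the cones of G form a
    closed, hence compact, subset of the power set of G, on which G acts by
    conjugation. Suppose that there are infinitely many cones and that a
    sequence e lists all of them. The contradiction is a cone P which is a limit
    of other cones and which is nevertheless determined by finitely many signs.

    The limit. By compactness there are non-isolated cones; they form a closed
    invariant set, and this set contains a minimal closed invariant set M. A
    nonempty closed set without isolated points is uncountable
    ([closed_has_isolated]), so M has isolated points, and by minimality M
    consists of isolated points. As M is compact, every element of G has a
    power that fixes a given P in M ([limit_cone_periodic]). Such a P satisfies
    Conrad's condition ([periodic_conradian]).

    The structure of P. Reversing the order on some of the layers between convex
    subgroups gives new cones, so a diagonal argument shows that P has only
    finitely many convex subgroups ([finite_hulls]). By Conrad's condition, each
    jump D < C of convex subgroups has D normal in C and C/D archimedean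
    ([conradian_jump]), hence abelian ([jump_comm], Hoelder's theorem).

    The use of countability. If D < C are subgroups with C convex, a cone on C/D
    can replace the part of P in C \ D ([glue_cone]), so C/D has only countably
    many orders. This excludes two kinds of sections. A torsion-free abelian
    group of rank at least two has uncountably many orders, one for each slope
    in a subgroup isomorphic to the square of the integers
    ([rank_two_section]). If E preserves the order of C/D by conjugation but acts
    nontrivially on it, then E acts by affine maps on a line, and each cut of the
    line gives an order ([affine_section]). Thus all jumps have rank
    one, and for consecutive jumps D < C < E some t in E reverses the order of
    C/D by conjugation ([flip_exists]).

    Isolation. Going up the finite series of convex subgroups, suppose that
    finitely many signs determine P on C. Let t > 1 lie in E \ C and reverse C/D.
    For f > 1 in C \ D the conjugate of f^-1 by t^-1 is positive in C, so any
    cone Q which contains t and agrees with P on C contains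
    t f^-1 = (t f^-1 t^-1) t. Hence t dominates C in Q, and rank one transfers
    this to all of E: the sign of t is the only new information
    ([determined_flip]). At the top of the series P is determined by
    finitely many signs ([conradian_determined]), as in Tararin's theorem. *)

(** * Positive cones *)

Record is_cone (G : groupType) (P : set G) : Prop := {
  coneN1 : ~ P 1;
  coneM : forall x y, P x -> P y -> P (x * y);
  coneT : forall x, x = 1 \/ P x \/ P x^-1
}.

Definition enumerates (G : groupType) (e : nat -> set G) :=
  forall P, is_cone P -> exists n, e n = P.

Section Cones.
Variable G : groupType.
Implicit Types (P Q : set G) (x y : G) (lt : G -> G -> Prop).

Lemma coneVN P x : is_cone P -> P x -> ~ P x^-1.
Proof. by move=> cP Px PVx; apply: (coneN1 cP); rewrite -(mulgV x); apply: (coneM cP). Qed.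

Lemma coneX P x n : is_cone P -> P x -> P (x ^+ n.+1).
Proof.
move=> cP Px; elim: n => // n IHn; rewrite expgS.
exact: (coneM cP).
Qed.

Lemma cone_eq P Q : is_cone P -> is_cone Q -> P `<=` Q -> P = Q.
Proof.
move=> cP cQ PQ; apply/seteqP; split=> // x Qx.
have [x1|[//|PVx]] := coneT cP x; first by case: (coneN1 cQ); rewrite -x1.
by case: (coneVN cQ Qx (PQ _ PVx)).
Qed.

Lemma cone_root P x n : is_cone P -> P (x ^+ n.+1) -> P x.
Proof.
move=> cP Pxn; have [x1|[//|PVx]] := coneT cP x.
  by case: (coneN1 cP); rewrite x1 expg1n in Pxn.
by case: (coneVN cP Pxn); rewrite -expVgn; apply: coneX.
Qed.

Definition positives lt : set G := [set x | lt 1 x].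
Definition order_of P : G -> G -> Prop := fun x y => P (x^-1 * y).

Lemma positives_cone lt : is_left_order lt -> is_cone (positives lt).
Proof.
move=> olt; split=> [|x y|x]; rewrite /positives /=.
- exact: left_order_irrefl.
- move=> x0 y0; apply: (left_order_trans olt x0).
  by have := left_order_mul olt x y0; rewrite mulg1.
- have [->|x1] := pselect (x = 1); first by left.
  right; have [[x0|x0] _] := left_order_total olt x1; last by left.
  by right; have := left_order_mul olt x^-1 x0; rewrite mulVg mulg1.
Qed.

Lemma order_of_left_order P : is_cone P -> is_left_order (order_of P).
Proof.
move=> cP; split; rewrite /order_of.
- by move=> x; rewrite mulVg; apply: coneN1.
- move=> x y xy; have xyV : (x^-1 * y)^-1 = y^-1 * x by rewrite !gnorm.
  split; last by move=> [Pxy]; rewrite -xyV; apply: coneVN.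
  rewrite -xyV; have [xy1|//] := coneT cP (x^-1 * y).
  by case: xy; rewrite -[y](mulVKg x) xy1 mulg1.
- move=> g x y Pgx Pxy; rewrite -(mulVKg x y) mulgA; exact: (coneM cP).
- by move=> g x y; rewrite !gnorm.
Qed.

Lemma positivesK lt : is_left_order lt -> order_of (positives lt) = lt.
Proof.
move=> olt; apply/funext => x; apply/funext => y; rewrite /order_of /positives /=.
apply/propext; split=> [xy|xy].
  by have := left_order_mul olt x xy; rewrite mulg1 mulVKg.
by have := left_order_mul olt x^-1 xy; rewrite mulVg.
Qed.

Lemma cones_enumerated : (left_orders G #= [set: nat])%card ->
  exists e : nat -> set G, enumerates e.
Proof.
move=> /card_set_bijP[f [_ finj _]].
exists (fun n => [set x | exists lt, [/\ is_left_order lt, f lt = n & lt 1 x]]).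
move=> P cP; exists (f (order_of P)); apply/seteqP; split=> x /=.
  move=> [lt [olt flt lt1x]].
  have ltP : lt = order_of P.
    by apply: finj => //; rewrite inE; last exact: order_of_left_order.
  by move: lt1x; rewrite ltP /order_of invg1 mul1g.
move=> Px; exists (order_of P); split=> //; first exact: order_of_left_order.
by rewrite /order_of invg1 mul1g.
Qed.

Lemma cones_infinite : (left_orders G #= [set: nat])%card ->
  forall s : seq (set G), exists2 P, is_cone P & ~ (P \in s).
Proof.
move=> oN s.
have inf : infinite_set (left_orders G).
  by apply/infiniteP; move: oN; rewrite card_eq_le => /andP[].
have fins : finite_set [set order_of P | P in [set` s]].
  exact/finite_image/finite_seq.
have [lt [olt nlt]] := infinite_setN0 (infinite_setD inf fins).
exists (positives lt); first exact: positives_cone.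
move=> ls; apply: nlt; exists (positives lt); [exact: ls|exact: positivesK].
Qed.

End Cones.

(** * Compactness of the space of cones *)

Section Compactness.
Variable G : groupType.
Implicit Types (P Q R : set G) (K A : set (set G)) (s : seq G).

Definition agree s P Q := forall x, x \in s -> P x = Q x.

Lemma agree_sym s P Q : agree s P Q -> agree s Q P.
Proof. by move=> PQ x xs; rewrite PQ. Qed.

Lemma agree_trans s P Q R : agree s P Q -> agree s Q R -> agree s P R.
Proof. by move=> PQ QR x xs; rewrite PQ ?QR. Qed.

Lemma agree_sub s t P Q : {subset s <= t} -> agree t P Q -> agree s P Q.
Proof. by move=> st PQ x /st; apply: PQ. Qed.

(** Closure in the topology of pointwise convergence, whose basic
    neighbourhoods are given by agreement on a finite list. *)
Definition adherent K Q := forall s, exists2 R, K R & agree s Q R.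

(** Compactness: the limit of an ultrafilter of cones consists of the elements
    that belong to almost all of them. *)
Lemma cone_compact (F : set (set (set G))) :
  F !=set0 -> (forall A, F A -> A !=set0 /\ A `<=` @is_cone G) ->
  (forall A B, F A -> F B -> exists2 C, F C & C `<=` A `&` B) ->
  exists2 Q, is_cone Q & forall A, F A -> adherent A Q.
Proof.
move=> [A0 FA0] FN0 FI.
have FF : ProperFilter (filter_from F id).
  apply: filter_from_proper; last by move=> A /FN0[].
  by apply: filter_from_filter; [exists A0|].
have [U [UU FU]] := ultraFilterLemma FF.
have UF A : F A -> U A by move=> FA; apply: FU; exists A.
have Ucone : U (@is_cone G) by apply: filterS (UF _ FA0); have [] := FN0 _ FA0.
exists [set x | U [set R | R x]].
  split=> [/(filterI Ucone)/filter_ex[R [/= cR]]|x y Ux Uy|x] /=.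
  - exact: coneN1.
  - apply: filterS (filterI Ucone (filterI Ux Uy)) => R [cR [/= Rx Ry]].
    exact: (coneM cR).
  - have [->|x1] := pselect (x = 1); first by left.
    right; have [Ux|Ux] := in_ultra_setVsetC [set R | R x] UU; first by left.
    right; apply: filterS (filterI Ucone Ux) => R [cR /= nRx].
    by case: (coneT cR x) => [//|[]].
move=> A FA s.
suff Us : U (agree s [set x | U [set R | R x]]).
  by have [R [AR sR]] := filter_ex (filterI (UF _ FA) Us); exists R.
elim: s => [|x s IHs]; first by apply: filterS filterT.
have Ux : U [set R | U [set R | R x] = R x].
  have [Ux|Ux] := in_ultra_setVsetC [set R | R x] UU.
    by apply: filterS (Ux) => R /= Rx; apply/propext.
  apply: filterS (Ux) => R /= nRx; apply/propext; split=> // Ux'.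
  by have [S []] := filter_ex (filterI Ux Ux').
apply: filterS (filterI Ux IHs) => R [/= Rx Rs] y.
by rewrite inE => /predU1P[->|/Rs].
Qed.

End Compactness.

(** * Limit cones and the conjugation action *)

Lemma dependent_sequence (T : Type) (I : T -> Prop) (r : nat -> T -> T -> Prop)
    (t0 : T) :
  I t0 -> (forall n t, I t -> exists2 t', I t' & r n t t') ->
  exists2 u : nat -> T, u 0%N = t0 & forall n, I (u n) /\ r n (u n) (u n.+1).
Proof.
move=> It0 step.
have /choice[f fP] : forall p : nat * T, exists t', I p.2 -> I t' /\ r p.1 p.2 t'.
  move=> [n t] /=.
  have [/(step n)[t' It' rt']|nIt] := pselect (I t); first by exists t'.
  by exists t.
pose u := fix u n := if n is m.+1 then f (m, u m) else t0.
exists u => // n; have Iu : I (u n) by elim: n => //= n /(fP (n, _))[].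
by split=> //; have [] := fP (n, u n) Iu.
Qed.

Section Dynamics.
Variable G : groupType.
Implicit Types (P Q R : set G) (K L M : set (set G)) (s : seq G) (g x : G).

Definition conj_cone g P : set G := [set x | P (x ^ g)].

Lemma conj_cone_cone g P : is_cone P -> is_cone (conj_cone g P).
Proof.
move=> cP; split=> [|x y|x]; rewrite /conj_cone /=.
- by rewrite conj1g; apply: coneN1.
- by rewrite conjMg; apply: coneM.
- case: (coneT cP (x ^ g)) => [/eqP|]; last by rewrite conjVg; right.
  by rewrite conjg_eq1 => /eqP; left.
Qed.

Lemma conj_coneM g h P : conj_cone g (conj_cone h P) = conj_cone (g * h) P.
Proof. by apply/funext => x; rewrite /conj_cone /= conjgM. Qed.

Lemma conj_cone1 P : conj_cone 1 P = P.
Proof. by apply/funext => x; rewrite /conj_cone /= conjg1. Qed.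

Lemma conj_cone_inj g P Q : conj_cone g P = conj_cone g Q -> P = Q.
Proof.
by move=> /(congr1 (conj_cone g^-1)); rewrite !conj_coneM mulVg !conj_cone1.
Qed.

Definition closed_cones K :=
  K `<=` @is_cone G /\ forall Q, adherent K Q -> K Q.

Definition conj_invariant K := forall g Q, K Q -> K (conj_cone g Q).

(** Cantor-Bendixson derivative. *)
Definition derived K : set (set G) :=
  [set Q | K Q /\ forall s, exists R, [/\ K R, R <> Q & agree s Q R]].

Lemma derived_sub K : derived K `<=` K.
Proof. by move=> Q []. Qed.

Lemma closed_cones_all : closed_cones (@is_cone G).
Proof.
split=> // Q adQ; split=> [Q1|x y Qx Qy|x].
- have [R cR sR] := adQ [:: 1]; apply: (coneN1 cR).
  by rewrite -sR // inE.
- have [R cR sR] := adQ [:: x; y; x * y].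
  by rewrite sR ?inE ?eqxx ?orbT //; apply: (coneM cR); rewrite -sR // !inE eqxx ?orbT.
- have [R cR sR] := adQ [:: x; x^-1].
  by rewrite !sR ?inE ?eqxx ?orbT //; apply: coneT.
Qed.

Lemma closed_derived K : closed_cones K -> closed_cones (derived K).
Proof.
move=> [Kcone Kcl]; split=> [Q /derived_sub/Kcone//|Q adQ].
split; first by apply: Kcl => s; have [R [KR _] sR] := adQ s; exists R.
move=> s; have [R dR sR] := adQ s.
have [RQ|RQ] := pselect (R = Q); first by rewrite -RQ; apply: dR.2.
by exists R; split=> //; apply: derived_sub.
Qed.

Lemma conj_invariant_derived K : conj_invariant K -> conj_invariant (derived K).
Proof.
move=> Kinv g Q [KQ dQ]; split; first exact: Kinv.
move=> s; have [R [KR RQ sR]] := dQ [seq x ^ g | x <- s].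
exists (conj_cone g R); split; [exact: Kinv|by move=> /conj_cone_inj|].
by move=> x xs; rewrite /conj_cone /= sR //; apply: map_f.
Qed.

(** Without isolated points one could choose R_n in K and growing finite lists
    such that R_n differs from e n on its list and all later members agree with
    R_n there; a limit of the R_n is then a cone missed by e. *)
Lemma closed_has_isolated (e : nat -> set G) K : enumerates e ->
  closed_cones K -> K !=set0 -> exists2 Q, K Q & ~ derived K Q.
Proof.
move=> eP [Kcone Kcl] [P0 KP0]; apply: contrapT => noiso.
have KdK Q : K Q -> derived K Q.
  by move=> KQ; apply: contrapT => dQ; apply: noiso; exists Q.
pose I (t : set G * seq G) := K t.1.
pose r n (t t' : set G * seq G) := [/\ {subset t.2 <= t'.2},
  agree t.2 t.1 t'.1 & ~ agree t'.2 t'.1 (e n)].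
have [n [P s] /= KP|u _ uP] := @dependent_sequence _ I r (P0, [::]) KP0.
  suff [R [KR sR eR]] : exists R, [/\ K R, agree s P R & R <> e n].
    have [x xP] : exists x, R x <> e n x.
      apply: contrapT => nx; apply: eR; apply/funext => x.
      by apply: contrapT => xP; apply: nx; exists x.
    exists (R, x :: s) => //; split=> //= [y ys|sRe]; first by rewrite inE ys orbT.
    by apply: xP; apply: sRe; rewrite inE eqxx.
  have [Pe|Pe] := pselect (P = e n); last by exists P; split.
  by have [_ /(_ s)[R [KR RP sR]]] := KdK _ KP; exists R; rewrite -Pe.
have mono m n : {subset (u m).2 <= (u (m + n)%N).2} /\
                agree (u m).2 (u m).1 (u (m + n)%N).1.
  elim: n => [|n [IHs IHa]]; first by rewrite addn0; split=> x.
  rewrite addnS; have [_ [us ua _]] := uP (m + n)%N; split.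
    by move=> x /IHs/us.
  exact: agree_trans IHa (agree_sub IHs ua).
pose A N : set (set G) := [set (u (N + n)%N).1 | n in setT].
have AK N : A N `<=` K by move=> Q [n _ <-]; have [] := uP (N + n)%N.
have [|||Q cQ adQ] := @cone_compact G [set A N | N in setT].
- by exists (A 0%N), 0%N.
- move=> _ [N _ <-]; split; first by exists (u (N + 0)%N).1, 0%N.
  by move=> Q /AK/Kcone.
- move=> _ _ [m _ <-] [n _ <-]; exists (A (m + n)%N); first by exists (m + n)%N.
  move=> Q [k _ <-]; split; first by exists (n + k)%N; rewrite ?addnA.
  by exists (m + k)%N => //; rewrite addnA (addnC n).
have [n en] := eP Q cQ.
have /(_ (u n.+1).2)[_ [k _ <-] sR] : adherent (A n.+1) Q by apply: adQ; exists n.+1.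
have [_ [_ _]] := uP n; apply; rewrite en.
exact: agree_trans (mono n.+1 k).2 (agree_sym sR).
Qed.

(** Zorn's lemma; compactness gives that the intersection of a chain is
    nonempty. *)
Lemma minimal_closed_invariant K :
  closed_cones K -> conj_invariant K -> K !=set0 ->
  exists M, [/\ closed_cones M, conj_invariant M, M !=set0, M `<=` K &
    forall L, closed_cones L -> conj_invariant L -> L !=set0 -> L `<=` M -> M `<=` L].
Proof.
move=> Kcl Kinv K0.
pose good L := [/\ closed_cones L, conj_invariant L, L !=set0 & L `<=` K].
pose T := {L | good L}.
have gK : good K by split.
pose r (s t : T) := `[< sval t `<=` sval s >].
have [||A Atot|[M gM] Mmax] := @ZL_preorder T (exist _ K gK) r.
- by move=> t; apply/asboolP.
- by move=> ? ? ? /asboolP ? /asboolP ?; apply/asboolP; apply: subset_trans; eassumption.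
- have [[t0 At0]|A0] := pselect (A !=set0); last first.
    by exists (exist _ K gK) => t At; case: A0; exists t.
  have gL : good (\bigcap_(t in A) sval t).
    have [cl0 inv0 ne0 sub0] := proj2_sig t0.
    split.
    - split=> [Q /(_ _ At0)|Q adQ t At]; first exact: cl0.1.
      have [[_ cl] _ _ _] := proj2_sig t; apply: cl => s.
      by have [R AR sR] := adQ s; exists R => //; apply: AR.
    - by move=> g Q AQ t At; have [_ + _ _] := proj2_sig t; apply; apply: AQ.
    - have [|||Q cQ adQ] := @cone_compact G [set sval t | t in A].
      + by exists (sval t0), t0.
      + by move=> _ [t At <-]; have [[]] := proj2_sig t.
      + move=> _ _ [t At <-] [t' At' <-].
        have [/asboolP tt'|/asboolP tt'] := Atot _ _ At At'.
          by exists (sval t') => //; [exists t'|move=> Q Qt; split=> //; apply: tt'].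
        by exists (sval t) => //; [exists t|move=> Q Qt; split=> //; apply: tt'].
      + exists Q => t At; have [[_ cl] _ _ _] := proj2_sig t; apply: cl.
        by apply: adQ; exists t.
    - by move=> Q /(_ _ At0)/sub0.
  by exists (exist _ _ gL) => t At; apply/asboolP => Q /(_ _ At).
exists M; have [clM invM neM subM] := gM; split=> // L clL invL neL LM.
have gL : good L by split=> // Q /LM/subM.
have /(_ (exist _ L gL)) := Mmax.
by move=> /(_ (asboolT LM))/asboolP.
Qed.

(** In a minimal closed invariant set of limit cones all points are isolated,
    because the non-isolated ones form a smaller closed invariant set. A limit
    of the conjugates of P by the powers of g is therefore attained infinitely
    often, so that two of these conjugates are equal. *)
Lemma limit_cone_periodic (e : nat -> set G) : enumerates e ->
  (forall s : seq (set G), exists2 P, is_cone P & ~ (P \in s)) ->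
  exists P, derived (@is_cone G) P /\
    forall g, exists k, conj_cone (g ^+ k.+1) P = P.
Proof.
move=> eP inf; pose K := derived (@is_cone G).
have clK : closed_cones K by exact: closed_derived closed_cones_all.
have invK : conj_invariant K.
  by apply: conj_invariant_derived => g Q; apply: conj_cone_cone.
have neK : K !=set0.
  pose A (s : seq (set G)) : set (set G) := [set P | is_cone P /\ ~ (P \in s)].
  have [|||Q cQ adQ] := @cone_compact G [set A s | s in setT].
  - by exists (A [::]), [::].
  - move=> _ [s _ <-]; split; last by move=> P [].
    by have [P cP Ps] := inf s; exists P.
  - move=> _ _ [s _ <-] [t _ <-]; exists (A (s ++ t)); first by exists (s ++ t).
    by move=> P [cP /negP]; rewrite mem_cat negb_or => /andP[/negP ? /negP ?].
  exists Q; split=> // s.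
  have /(_ s)[R [cR RQ] sR] : adherent (A [:: Q]) Q by apply: adQ; exists [:: Q].
  by exists R; split=> // RQ'; apply: RQ; rewrite RQ' inE.
have [M [clM invM neM MK Mmin]] := minimal_closed_invariant clK invK neK.
have dM0 Q : ~ derived M Q.
  move=> dQ; have [R MR] := closed_has_isolated eP clM neM; apply.
  apply: Mmin MR; [exact: closed_derived|exact: conj_invariant_derived| |].
    by exists Q.
  exact: derived_sub.
have [P MP] := neM; exists P; split; first exact: MK.
move=> g; pose A N : set (set G) := [set conj_cone (g ^+ (N + n)) P | n in setT].
have AM N : A N `<=` M by move=> _ [n _ <-]; apply: invM.
have [|||Q cQ adQ] := @cone_compact G [set A N | N in setT].
- by exists (A 0%N), 0%N.
- move=> _ [N _ <-]; split; first by exists (conj_cone (g ^+ (N + 0)) P), 0%N.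
  by move=> Q /AM; apply: clM.1.
- move=> _ _ [m _ <-] [n _ <-]; exists (A (m + n)%N); first by exists (m + n)%N.
  move=> Q [k _ <-]; split; first by exists (n + k)%N; rewrite ?addnA.
  by exists (m + k)%N => //; rewrite addnA (addnC n).
have AQ N : A N Q.
  have adN : adherent (A N) Q by apply: adQ; exists N.
  have MQ : M Q by apply: clM.2 => s; have [R /AM MR sR] := adN s; exists R.
  apply: contrapT => nAQ; apply: (dM0 Q); split=> // s.
  have [R AR sR] := adN s; exists R; split=> //; first exact: AM AR.
  by move=> RQ; apply: nAQ; rewrite -RQ.
have [i _ iQ] := AQ 0%N; have [j _ jQ] := AQ (0 + i).+1%N.
exists j; apply: (@conj_cone_inj (g ^+ (0 + i))); rewrite iQ conj_coneM -expgnDr.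
by rewrite addnS -addSn.
Qed.

End Dynamics.

(** * Convex subgroups *)

Record is_subgroup (G : groupType) (H : set G) : Prop := {
  subgroup1 : H 1;
  subgroupM : forall x y, H x -> H y -> H (x * y);
  subgroupV : forall x, H x -> H x^-1
}.

(** Convexity is stated for intervals 1 < x < y; translation gives the others. *)
Record is_convex (G : groupType) (P C : set G) : Prop := {
  convex_subgroup :> is_subgroup C;
  convexP : forall x y, P x -> P (x^-1 * y) -> C y -> C x
}.

Section Subgroups.
Variable G : groupType.
Implicit Types (H : set G) (x y : G).

Lemma subgroupVE H x : is_subgroup H -> H x^-1 = H x.
Proof.
move=> sH; apply/propext; split; last exact: subgroupV.
by move=> /(subgroupV sH); rewrite invgK.
Qed.

Lemma subgroupMl H x y : is_subgroup H -> H x -> H (x * y) = H y.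
Proof.
move=> sH Hx; apply/propext; split; last exact: subgroupM.
by move=> /(subgroupM sH (subgroupV sH Hx)); rewrite mulKg.
Qed.

Lemma subgroupMr H x y : is_subgroup H -> H y -> H (x * y) = H x.
Proof.
move=> sH Hy; apply/propext; split; last by move=> Hx; apply: subgroupM.
by move=> Hxy; have := subgroupM sH Hxy (subgroupV sH Hy); rewrite mulgK.
Qed.

Lemma subgroupX H x n : is_subgroup H -> H x -> H (x ^+ n).
Proof.
move=> sH Hx; elim: n => [|n IHn]; first exact: subgroup1.
by rewrite expgS; apply: subgroupM.
Qed.

Lemma subgroupJ H x y : is_subgroup H -> H x -> H y -> H (x ^ y).
Proof.
by move=> sH Hx Hy; rewrite conjgE; do !apply: subgroupM => //; apply: subgroupV.
Qed.

End Subgroups.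

Section Convexity.
Variable G : groupType.
Implicit Types (P Q C D : set G) (x y g : G).

Lemma convexMl P C c x : is_cone P -> is_convex P C ->
  C c -> ~ C x -> P x -> P (c * x).
Proof.
move=> cP vC Cc nCx Px; have [cx|[//|PcxV]] := coneT cP (c * x).
  by case: nCx; rewrite -(mulKg c x) cx mulg1; apply: (subgroupV vC).
case: nCx; apply: (convexP vC Px (y := c^-1)); last exact: (subgroupV vC).
by move: PcxV; rewrite invgM.
Qed.

Lemma convexMr P C c x : is_cone P -> is_convex P C ->
  C c -> ~ C x -> P x -> P (x * c).
Proof.
move=> cP vC Cc nCx Px; have [xc|[//|PxcV]] := coneT cP (x * c).
  by case: nCx; rewrite -(mulgK c x) xc mul1g; apply: (subgroupV vC).
case: nCx; rewrite -(subgroupMr _ vC Cc) -(subgroupVE _ vC).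
apply: (convexP vC PxcV (y := c^-1)); last exact: (subgroupV vC).
by rewrite invgK mulgK.
Qed.

(** Of two positive elements that witness the failure of both inclusions, the
    smaller one contradicts convexity. *)
Lemma convex_total P C D : is_cone P -> is_convex P C -> is_convex P D ->
  C `<=` D \/ D `<=` C.
Proof.
move=> cP vC vD; have [|/existsNP[x /not_implyP[Cx nDx]]] := pselect (C `<=` D); first by left.
right => y Dy; apply: contrapT => nCy.
have wlogP z (A B : set G) : is_convex P A -> is_convex P B -> A z -> ~ B z ->
    exists2 z', P z' & A z' /\ ~ B z'.
  move=> vA vB Az nBz; have [z1|[Pz|PVz]] := coneT cP z; [|by exists z|].
    by case: nBz; rewrite z1; apply: subgroup1 vB.
  by exists z^-1; rewrite ?(subgroupVE _ vA) ?(subgroupVE _ vB).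
have {x Cx nDx} [x Px [Cx nDx]] := wlogP _ _ _ vC vD Cx nDx.
have {y Dy nCy} [y Py [Dy nCy]] := wlogP _ _ _ vD vC Dy nCy.
have := convexMl cP vC (subgroupV vC Cx) nCy Py.
by move=> /(convexP vD Px)/(_ Dy).
Qed.

(** The principal convex subgroup of g. *)
Definition hull P g : set G := [set x | forall C, is_convex P C -> C g -> C x].

Lemma hull_convex P g : is_convex P (hull P g).
Proof.
split; first split=> [C vC _|x y hx hy C vC Cg|x hx C vC Cg].
- exact: subgroup1 vC.
- by apply: (subgroupM vC); [apply: hx|apply: hy].
- by apply: (subgroupV vC); apply: hx.
- by move=> x y Px xy hy C vC Cg; apply: (convexP vC Px xy); apply: hy.
Qed.

Lemma hull_id P g : hull P g g.
Proof. by []. Qed.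
Arguments hull_id : clear implicits.
#[local] Hint Resolve hull_id : core.

Lemma hull_sub P C g : is_convex P C -> C g -> hull P g `<=` C.
Proof. by move=> vC Cg x; apply. Qed.

Lemma hullV P g : hull P g^-1 = hull P g.
Proof.
apply/seteqP; split; apply: hull_sub; try exact: hull_convex.
  by apply: (subgroupV (hull_convex _ _)).
by rewrite -(subgroupVE _ (hull_convex _ _)).
Qed.

Lemma hullM P x y : is_cone P -> P x -> P y -> hull P x = hull P y ->
  hull P (x * y) = hull P y.
Proof.
move=> cP Px Py xy; have vy := hull_convex P y.
apply/seteqP; split; first by apply: hull_sub => //; apply: (subgroupM vy) => //; rewrite -xy.
rewrite -xy; apply: hull_sub; first exact: hull_convex.
by apply: (convexP (hull_convex _ _) Px (y := x * y)) => //; rewrite mulKg.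
Qed.

Lemma hullM_dom P x y : is_cone P -> ~ hull P x y ->
  hull P (x * y) = hull P y /\ hull P (y * x) = hull P y.
Proof.
move=> cP nxy; have vx := hull_convex P x; have vy := hull_convex P y.
have yx : hull P y x.
  by have [/(_ _ (hull_id P _))|/(_ _ (hull_id P _))/nxy] := convex_total cP vx vy.
suff dom z : hull P y z -> ~ hull P x z -> (hull P z x -> hull P z y) -> hull P z = hull P y.
  split; apply: dom.
  - exact: (subgroupM vy).
  - by rewrite (subgroupMl _ vx).
  - by move=> zx; rewrite -(subgroupMl _ (hull_convex _ _) zx).
  - exact: (subgroupM vy).
  - by rewrite (subgroupMr _ vx).
  - by move=> zx; rewrite -(subgroupMr _ (hull_convex _ _) zx).
move=> yz xz zxy; have vz := hull_convex P z.
apply/seteqP; split; first exact: hull_sub.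
apply: hull_sub => //; apply: zxy.
by have [/(_ _ (hull_id P _))|/(_ _ (hull_id P _))/xz] := convex_total cP vx vz.
Qed.

Definition flip P (eps : set (set G)) : set G :=
  [set x | (P x /\ ~ eps (hull P x)) \/ (P x^-1 /\ eps (hull P x))].

(** The sign and the hull of a product are those of the factor with the larger
    hull; for equal hulls and equal signs the hull of the product is the same. *)
Lemma flip_cone P eps : is_cone P -> is_cone (flip P eps).
Proof.
move=> cP; have n1 := coneN1 cP; split=> [|x y Qx Qy|x].
- by rewrite /flip /= invg1 => -[] [].
- have dom u v : ~ hull P u v -> flip P eps v -> flip P eps (u * v) /\ flip P eps (v * u).
    move=> nuv; have [uv vu] := hullM_dom cP nuv; have hu := hull_convex P u.
    rewrite /flip /= uv vu !invgM.
    have hVu := subgroupV hu (hull_id P u).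
    have nuVv : ~ hull P u v^-1 by rewrite (subgroupVE _ hu).
    move=> [[Pv ev]|[PVv ev]]; split; [left|left|right|right]; split=> //.
    + exact: (convexMl cP hu).
    + exact: (convexMr cP hu).
    + exact: (convexMr cP hu).
    + exact: (convexMl cP hu).
  have [xy|nxy] := pselect (hull P x y); last by have [] := dom _ _ nxy Qy.
  have [yx|nyx] := pselect (hull P y x); last by have [] := dom _ _ nyx Qx.
  have exy : hull P x = hull P y.
    by apply/seteqP; split; apply: hull_sub => //; apply: hull_convex.
  move: Qx Qy; rewrite /flip /= exy => -[[Px ex]|[PVx ex]] [[Py ey]|[PVy ey]] //.
    by left; rewrite hullM //; split=> //; apply: coneM.
  right; rewrite -(hullV _ (x * y)) invgM hullM ?hullV ?exy //; split=> //.
  exact: (coneM cP).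
- have [->|[Px|PVx]] := coneT cP x; first by left.
    by right; rewrite /flip /= hullV invgK; have [] := pselect (eps (hull P x)); [right; right|left; left].
  by right; rewrite /flip /= hullV invgK; have [] := pselect (eps (hull P x)); [left; right|right; left].
Qed.

(** Infinitely many hulls, generated by positive g 0, g 1, ..., would allow a
    flip whose sign at g n differs from that of e n for all n. *)
Lemma finite_hulls (e : nat -> set G) P : enumerates e -> is_cone P ->
  finite_set (range (hull P)).
Proof.
move=> eP cP.
suff fin : finite_set [set hull P x | x in P].
  apply: (@sub_finite_set _ _ ([set hull P x | x in P] `|` [set hull P 1])).
    move=> _ [x _ <-]; have [->|[Px|PVx]] := coneT cP x; first by right.
      by left; exists x.
    by left; exists x^-1 => //; rewrite hullV.
  by rewrite finite_setU; split=> //; apply: finite_set1.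
apply: contrapT => /infiniteP/card_leP[f].
have /choice[g gP] n : exists x, P x /\ hull P x = set_val (f (to_setT n)).
  by have [x Px xf] := set_valP (f (to_setT n)); exists x.
have ginj m n : hull P (g m) = hull P (g n) -> m = n.
  rewrite !(gP _).2 => /val_inj/(@inj _ _ _ f); rewrite !inE => /(_ I I).
  by move=> /(congr1 set_val).
pose eps H := exists n, H = hull P (g n) /\ e n (g n).
have [n en] := eP _ (flip_cone eps cP).
have : ~ e n (g n) <-> e n (g n).
  rewrite {2}en /flip /=; split=> [nen|[[_ neps] en'|[/(coneVN cP (gP n).1)]]].
    left; split; first exact: (gP n).1.
    by move=> [m [/ginj <-]].
    by apply: neps; exists n.
    by [].
by have [en'|en'] := pselect (e n (g n)); tauto.
Qed.

End Convexity.

Arguments hull_id {G} P g.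
#[global] Hint Resolve hull_id : core.

Lemma seq_total_max (T : eqType) (r : T -> T -> Prop) (s : seq T) :
  (forall x y z, r x y -> r y z -> r x z) ->
  {in s &, forall x y, r x y \/ r y x} -> s != [::] ->
  exists2 m, m \in s & {in s, forall x, r x m}.
Proof.
move=> rtr; elim: s => // x s IHs rtot _.
have rxx : r x x by have [] := rtot x x (mem_head x s) (mem_head x s).
have [->|s0] := eqVneq s [::].
  by exists x; rewrite ?inE // => y; rewrite inE => /eqP->.
have [//|m ms mM] := IHs _ s0.
  by move=> y z ys zs; apply: rtot; rewrite inE ?ys ?zs orbT.
have ms' : m \in x :: s by rewrite inE ms orbT.
have [xm|mx] := rtot x m (mem_head x s) ms'.
  by exists m => // y; rewrite inE => /predU1P[->|/mM].
exists x; first exact: mem_head.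
by move=> y; rewrite inE => /predU1P[->|/mM ym] //; apply: rtr ym mx.
Qed.

Section FiniteHulls.
Variables (G : groupType) (e : nat -> set G) (P : set G).

Lemma hull_extremum (r : set G -> set G -> Prop) (B : set G) :
  enumerates e -> is_cone P ->
  (forall x y z, r x y -> r y z -> r x z) ->
  (forall x y, r (hull P x) (hull P y) \/ r (hull P y) (hull P x)) ->
  B !=set0 -> exists2 h, B h & forall x, B x -> r (hull P x) (hull P h).
Proof.
move=> eP cP rtr rtot [b Bb].
have /finite_seqP[s sP] : finite_set [set hull P x | x in B].
  by apply: sub_finite_set (finite_hulls eP cP) => _ [x _ <-]; exists x.
have sE H : (H \in s) = [set hull P x | x in B] H :> Prop by rewrite sP.
have [|||m] := @seq_total_max _ r s.
- exact: rtr.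
- by move=> H K; rewrite !sE => -[x _ <-] [y _ <-].
- apply/eqP => s0; have : hull P b \in s by rewrite sE; exists b.
  by rewrite s0.
rewrite sE => -[h Bh <-] hM; exists h => // x Bx; apply: hM.
by rewrite sE; exists x.
Qed.

(** Among the finitely many hulls of elements of C there is a largest one. *)
Lemma convex_principal (C : set G) : enumerates e -> is_cone P ->
  is_convex P C -> exists2 h, C h & C = hull P h.
Proof.
move=> eP cP vC.
have [|||h Ch hM] := @hull_extremum subset C eP cP.
- by move=> X Y Z; apply: subset_trans.
- by move=> x y; apply: (convex_total cP); apply: hull_convex.
- by exists 1; apply: subgroup1 vC.
exists h => //; apply/seteqP; split; last exact: hull_sub.
by move=> x /hM; apply; apply: hull_id.
Qed.

End FiniteHulls.

(** * Conrad's condition *)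

(** Conrad's condition in the form g < f g^2; it is equivalent to the existence,
    for all positive f and g, of some n with g < f g^n. *)
Definition conradian (G : groupType) (P : set G) :=
  forall f g, P f -> P g -> P (f ^ g * g).

Section Conrad.
Variable G : groupType.
Implicit Types (P C D : set G) (x y g : G).

(** If conjugation by g^(k+1) fixes P, then f g^(k+1) > g^(k+1) >= g. The
    exponent can then be lowered to 2: otherwise h = f g satisfies h g <= g, so
    h^n g <= g for all n, against the weak condition for f and h. *)
Lemma periodic_conradian P : is_cone P ->
  (forall g, exists k, conj_cone (g ^+ k.+1) P = P) -> conradian P.
Proof.
move=> cP per.
have weak f g : P f -> P g -> exists n, P (f ^ g * g ^+ n).
  move=> Pf Pg; have [k kP] := per g; exists k.
  have Pfk : P (f ^ (g ^+ k.+1)) by rewrite -kP in Pf.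
  have -> : f ^ g * g ^+ k = g ^+ k * f ^ (g ^+ k.+1).
    by rewrite !conjgE expgS !gnorm.
  case: k {kP} Pfk => [|k] Pfk; first by rewrite mul1g.
  by apply: (coneM cP) => //; apply: coneX.
move=> f g Pf Pg; apply: contrapT => nP; pose h := f * g.
have Ph : P h by exact: (coneM cP).
have hgV : P ((h^-1) ^ g).
  have [h1|[|]] := coneT cP (h ^ g).
    by case: (coneN1 cP); move/eqP: h1 Ph; rewrite conjg_eq1 => /eqP->.
    by have -> : h ^ g = f ^ g * g by rewrite /h !conjgE !gnorm.
  by rewrite conjVg.
have [n nP'] := weak f h Pf Ph.
apply: (coneN1 cP).
(* h < f h^(n+1) < f h^(n+1) g < f g = h *)
have -> : 1 = (f ^ h * h ^+ n) * g * (h^-1 ^ g) ^+ n.+1.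
  by rewrite -conjXg expVgn !conjgE expgS !gnorm.
by apply: (coneM cP); [apply: (coneM cP)|apply: coneX].
Qed.

(** Conrad's condition makes the set of elements bounded by powers of g, together
    with their inverses, closed under products; it is a convex subgroup. *)
Lemma conradian_archimedean P g x : is_cone P -> conradian P -> P g ->
  hull P g x -> exists n, P (x^-1 * g ^+ n.+1).
Proof.
move=> cP Pc Pg; pose B x := exists n, P (x^-1 * g ^+ n.+1).
(* If y < g^n, then y g^m < g^(n+2m) by Conrad's condition for y^-1 g^n and g^m. *)
have BM y z : B y -> B z -> B (y * z).
  move=> [n yn] [m zm]; exists (n.+1 + m.+1 + m)%N.
  have := coneM cP zm (Pc _ _ yn (coneX m cP Pg)).
  by rewrite -addnS !expgnDr !conjgE !gnorm.
have BP y : P y^-1 -> B y by move=> Py; exists 0%N; apply: (coneM cP).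
suff vB : is_convex P [set x | B x /\ B x^-1].
  move=> /(_ _ vB) []//; split; first by exists 1%N; rewrite expgS mulKg.
  by apply: BP; rewrite invgK.
split; first split=> [|y z [By BVy] [Bz BVz]|y [By BVy]] /=.
- by rewrite invg1; split; exists 0%N; rewrite invg1 mul1g.
- by rewrite invgM; split; apply: BM.
- by rewrite invgK.
move=> y z Py yz [[n zn] _]; split; last by apply: BP; rewrite invgK.
by exists n; have := coneM cP yz zn; rewrite !gnorm.
Qed.

(** The elements of C that are positive, or nonnegative, in the ordered group
    C/D; in this form computations modulo D stay in G. *)
Definition section_pos P C D : set G := [set x | [/\ P x, C x & ~ D x]].
Definition section_nneg P C D : set G := [set x | C x /\ (D x \/ P x)].

(** [jump_normal] and [jump_pos] make C/D a bi-ordered group, and [jump_arch] makes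
    it archimedean. *)
Record is_jump P C D : Prop := {
  jump_lower : is_convex P D;
  jump_upper : is_convex P C;
  jump_sub : D `<=` C;
  jump_neq : exists x, C x /\ ~ D x;
  jump_normal : forall x g, C g -> D x -> D (x ^ g);
  jump_pos : forall x g, C g -> section_pos P C D x -> section_pos P C D (x ^ g);
  jump_arch : forall x y, section_pos P C D x -> C y ->
    exists n, P (y^-1 * x ^+ n.+1)
}.

(** If all powers of x stay below |h|, then the conjugate of x by h cannot have
    powers that exceed h^2 and h^-1. For h > 1 this is Conrad's condition applied
    to x^-n h and h; for h < 1 it only uses left invariance. *)
Lemma conj_dominated P C x h : is_cone P -> conradian P -> C h ->
  (forall y, C y -> exists n, P (y^-1 * (x ^ h) ^+ n.+1)) ->
  (forall u n, u = h \/ u = h^-1 -> P u ->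
     P (x ^- n.+1 * u) /\ P (u * x ^- n.+1)) ->
  is_subgroup C -> h <> 1 -> False.
Proof.
move=> cP Pc Ch arch dom sC h1; apply: (coneN1 cP).
have [//|[Ph|PVh]] := coneT cP h.
  have [n] := arch (h ^+ 2) (subgroupX 2 sC Ch).
  have [Pxh _] := dom h n (or_introl erefl) Ph.
  move=> /(coneM cP)/(_ (Pc _ _ Pxh Ph)).
  by rewrite -conjXg !conjgE !expgS !expg0 !gnorm.
have [n] := arch h^-1 (subgroupV sC Ch).
have [_ PhVx] := dom h^-1 n (or_intror erefl) PVh.
move=> /(coneM cP PhVx).
by rewrite -conjXg !conjgE !gnorm.
Qed.
End Conrad.

(** * Jumps of convex subgroups *)

Section Jumps.
Variable G : groupType.
Implicit Types (P C D : set G) (x y z g : G).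

(** The union of the convex subgroups of hull P g that do not contain g. *)
Definition below P g : set G := [set x | hull P g x /\ ~ hull P x g].

Lemma trivial_convex P : is_cone P -> is_convex P [set 1].
Proof.
move=> cP; split; first split=> [//|x y -> ->|x ->]; rewrite /= ?mulg1 ?invg1 //.
by move=> x y Px + y1; rewrite y1 mulg1 => /(coneVN cP Px).
Qed.

Lemma below_convex P g : is_cone P -> g <> 1 -> is_convex P (below P g).
Proof.
move=> cP g1; have vh x := hull_convex P x.
split; first split=> [|x y [gx nxg] [gy nyg]|x [gx nxg]].
- split; first exact: (subgroup1 (vh g)).
  by move=> /(_ _ (trivial_convex cP))/(_ erefl).
- split; first exact: (subgroupM (vh g) gx gy).
  have [xy|yx] := convex_total cP (vh x) (vh y) => hg.
    apply: nyg; apply: (hull_sub (vh y)) hg; apply: (subgroupM (vh y)).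
      by apply: xy.
    exact: hull_id.
  apply: nxg; apply: (hull_sub (vh x)) hg; apply: (subgroupM (vh x)).
    exact: hull_id.
  by apply: yx.
- by split; [exact: (subgroupV (vh g) gx)|rewrite hullV].
- move=> x y Px xy [gy nyg]; split; first exact: (convexP (vh g) Px xy gy).
  move=> xg; apply: nyg; apply: (hull_sub (vh y)) xg.
  apply: (convexP (vh y) Px xy); exact: hull_id.
Qed.

(** Both the normality of the lower subgroup and the invariance of positivity
    under conjugation follow from [conj_dominated]: a violation would be an
    element x with small or negative powers which has a large conjugate. *)
Lemma conradian_jump P g : is_cone P -> conradian P -> g <> 1 ->
  is_jump P (hull P g) (below P g).
Proof.
move=> cP Pc g1; set C := hull P g; set D := below P g.
have vC : is_convex P C by exact: hull_convex.
have vD : is_convex P D by exact: below_convex.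
have DC : D `<=` C by move=> x [].
have arch x y : section_pos P C D x -> C y -> exists n, P (y^-1 * x ^+ n.+1).
  move=> [Px Cx nDx] Cy; apply: (conradian_archimedean cP Pc Px).
  apply: (hull_sub (hull_convex P x)) Cy.
  by apply: contrapT => nxg; apply: nDx.
have dom x h u : D x -> ~ D h -> u = h \/ u = h^-1 -> P u -> P (x * u) /\ P (u * x).
  move=> Dx nDh uh Pu; have nDu : ~ D u by case: uh => ->; rewrite ?(subgroupVE _ vD).
  by split; [exact: (convexMl cP vD)|exact: (convexMr cP vD)].
have normal x h : C h -> D x -> D (x ^ h).
  move=> Ch Dx; have [Dh|nDh] := pselect (D h); first exact: (subgroupJ vD).
  have h1 : h <> 1 by move=> h1; apply: nDh; rewrite h1; apply: (subgroup1 vD).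
  have pos y : D y -> P (y ^ h) -> D (y ^ h).
    move=> Dy Pyh; apply: contrapT => nDyh.
    apply: (conj_dominated cP Pc Ch (x := y) _ _ vC h1).
      move=> z; apply: arch; split=> //; apply: (subgroupJ vC) => //; exact: DC.
    by move=> u n uh; apply: (dom _ h) => //; apply/(subgroupV vD)/(subgroupX _ vD).
  have [->|[|Px]] := coneT cP (x ^ h); [exact: (subgroup1 vD)|exact: pos|].
  rewrite -(subgroupVE _ vD) -conjVg; apply: pos; first exact: (subgroupV vD).
  by rewrite conjVg.
split=> //; first by exists g; split=> [|[_]]; [exact: hull_id|apply; exact: hull_id].
move=> x h Ch [Px Cx nDx]; have Cxh := subgroupJ vC Cx Ch.
have nDxh : ~ D (x ^ h).
  by move=> /(normal _ h^-1 (subgroupV vC Ch)); rewrite conjgK.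
split=> //; have [xh1|[//|PVxh]] := coneT cP (x ^ h).
  by case: nDxh; rewrite xh1; apply: (subgroup1 vD).
have [h1|/eqP h1] := eqVneq h 1; first by rewrite h1 conjg1.
case: (@conj_dominated _ P C x^-1 h cP Pc Ch _ _ vC h1).
  move=> y; apply: arch; rewrite conjVg; split=> //; first exact: (subgroupV vC).
  by rewrite (subgroupVE _ vD).
move=> u n _ Pu; rewrite expVgn invgK.
by split; apply: (coneM cP) => //; apply: coneX.
Qed.

Lemma nneg1 P C D : is_jump P C D -> section_nneg P C D 1.
Proof.
by move=> J; split; [exact: (subgroup1 (jump_upper J))|left; exact: (subgroup1 (jump_lower J))].
Qed.

Lemma pos_nneg P C D x : section_pos P C D x -> section_nneg P C D x.
Proof. by move=> [Px Cx _]; split=> //; right. Qed.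

Lemma lower_nneg P C D x : is_jump P C D -> D x -> section_nneg P C D x.
Proof. by move=> J Dx; split; [exact: (jump_sub J)|left]. Qed.

Lemma nnegE P C D x : section_nneg P C D x -> D x \/ section_pos P C D x.
Proof.
move=> [Cx Dx]; have [|nDx] := pselect (D x); first by left.
by right; case: Dx.
Qed.

Lemma posM_nneg P C D x y : is_cone P -> is_jump P C D ->
  section_pos P C D x -> section_nneg P C D y -> section_pos P C D (x * y).
Proof.
move=> cP J [Px Cx nDx] /nnegE[Dy|[Py Cy nDy]].
  have Cy := jump_sub J Dy; split; first exact: (convexMr cP (jump_lower J)).
    exact: (subgroupM (jump_upper J)).
  by rewrite (subgroupMr _ (jump_lower J)).
split; [exact: (coneM cP)|exact: (subgroupM (jump_upper J))|] => Dxy.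
by apply/nDx/(convexP (jump_lower J) Px _ Dxy); rewrite mulKg.
Qed.

Lemma nnegM_pos P C D x y : is_cone P -> is_jump P C D ->
  section_nneg P C D x -> section_pos P C D y -> section_pos P C D (x * y).
Proof.
move=> cP J /nnegE[Dx|px] py; last exact/(posM_nneg cP J px)/pos_nneg.
have [Py Cy nDy] := py; have Cx := jump_sub J Dx; split.
- exact: (convexMl cP (jump_lower J)).
- exact: (subgroupM (jump_upper J)).
- by rewrite (subgroupMl _ (jump_lower J)).
Qed.

Lemma nnegM P C D x y : is_cone P -> is_jump P C D ->
  section_nneg P C D x -> section_nneg P C D y -> section_nneg P C D (x * y).
Proof.
move=> cP J /nnegE[Dx /nnegE[Dy|sy]|sx ny].
- by apply: (lower_nneg J); apply: (subgroupM (jump_lower J)).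
- by apply/pos_nneg/(nnegM_pos cP J) => //; apply: lower_nneg.
- exact/pos_nneg/(posM_nneg cP J).
Qed.

Lemma nnegJ P C D x g : is_jump P C D -> C g ->
  section_nneg P C D x -> section_nneg P C D (x ^ g).
Proof.
move=> J Cg /nnegE[Dx|/(jump_pos J Cg)/pos_nneg//].
exact/(lower_nneg J)/(jump_normal J).
Qed.

Lemma section_trichotomy P C D x : is_cone P -> is_jump P C D -> C x ->
  section_nneg P C D x \/ section_pos P C D x^-1.
Proof.
move=> cP J Cx; have [Dx|nDx] := pselect (D x); first by left; apply: lower_nneg.
have [x1|[Px|PVx]] := coneT cP x.
- by left; rewrite x1; apply: nneg1.
- by left; split=> //; right.
- right; split=> //; first exact: (subgroupV (jump_upper J)).
  by rewrite (subgroupVE _ (jump_lower J)).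
Qed.

Lemma pos_nnegVN P C D x : is_cone P -> is_jump P C D ->
  section_pos P C D x -> ~ section_nneg P C D x^-1.
Proof.
move=> cP J sx nx; have [_ _] := posM_nneg cP J sx nx.
by rewrite mulgV; apply; apply: (subgroup1 (jump_lower J)).
Qed.

Lemma nnegX P C D x n : is_cone P -> is_jump P C D ->
  section_nneg P C D x -> section_nneg P C D (x ^+ n).
Proof.
move=> cP J nx; elim: n => [|n IHn]; first exact: nneg1.
by rewrite expgS; apply: nnegM.
Qed.

Lemma posX P C D x n : is_cone P -> is_jump P C D ->
  section_pos P C D x -> section_pos P C D (x ^+ n.+1).
Proof.
move=> cP J px; rewrite expgS; apply: posM_nneg => //.
exact/nnegX/pos_nneg.
Qed.

(** Division with remainder by z in the archimedean group C/D. *)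
Lemma section_division P C D z x : is_cone P -> is_jump P C D ->
  section_pos P C D z -> section_nneg P C D x ->
  exists m r, [/\ x = z ^+ m * r, section_nneg P C D r & section_pos P C D (r^-1 * z)].
Proof.
move=> cP J pz nx; have [Pz Cz nDz] := pz; have [Cx _] := nx.
have sC := jump_upper J.
have [n0 n0P] : exists n, `[< section_pos P C D (x^-1 * z ^+ n) >].
  have [n xn] := jump_arch J pz Cx; exists n.+2; apply/asboolP.
  rewrite expgSr mulgA; apply: nnegM_pos => //; split; last by right.
  exact: (subgroupM sC (subgroupV sC Cx) (subgroupX _ sC Cz)).
case: (ex_minnP (ex_intro (fun n => `[< _ >]) n0 n0P)) => -[|m] /asboolP mP mmin.
  by case: (pos_nnegVN cP J mP); rewrite expg0 mulg1 invgK.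
exists m, (z ^- m * x); split; first by rewrite mulVKg.
  have Cr : C (z ^- m * x) by exact: (subgroupM sC (subgroupV sC (subgroupX _ sC Cz)) Cx).
  have [//|] := section_trichotomy cP J Cr.
  by rewrite invgM invgK => /asboolP/mmin; rewrite ltnn.
by rewrite invgM invgK -mulgA -expgSr.
Qed.

(** Hoelder's theorem. If the commutator c of u, v > 1 is positive and some
    z > 1 satisfies z^2 <= c, compare u and v with the powers of z: the error in
    the commutator is less than z^2. If there is no such z, then c is the least
    positive element and C/D is cyclic. *)
Lemma jump_comm P C D x y : is_cone P -> is_jump P C D -> C x -> C y -> D [~ x, y].
Proof.
move=> cP J; have sC := jump_upper J; have sD := jump_lower J.
suff main u v : section_pos P C D u -> section_pos P C D v -> ~ section_pos P C D [~ u, v].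
  have main2 u v : section_nneg P C D u -> section_nneg P C D v -> D [~ u, v].
    move=> nu nv; have Cu := nu.1; have Cv := nv.1.
    case: (nnegE nu) => [Du|pu].
      by rewrite commgEl; apply: (subgroupM sD); [exact: (subgroupV sD)|exact: (jump_normal J)].
    case: (nnegE nv) => [Dv|pv].
      rewrite commgEr; apply: (subgroupM sD) => //; apply: (jump_normal J) => //.
      exact: (subgroupV sD).
    apply: contrapT => nDc.
    have Cc : C [~ u, v] by rewrite commgEl; apply: (subgroupM sC (subgroupV sC Cu)); exact: (subgroupJ sC).
    have [/nnegE[//|]|] := section_trichotomy cP J Cc; first exact: main.
    by rewrite invgR; apply: main.
  move=> Cx Cy.
  have flipl u v : C u -> C v -> D [~ u^-1, v] -> D [~ u, v].
    move=> Cu Cv /(jump_normal J Cu)/(subgroupV sD).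
    by congr (D _); rewrite !commgEl !conjgE !gnorm.
  have flipr u v : C u -> C v -> D [~ u, v^-1] -> D [~ u, v].
    move=> Cu Cv; rewrite -(subgroupVE _ sD) invgR => /(flipl _ _ Cv Cu).
    by move=> /(subgroupV sD); rewrite invgR.
  have [nx|/pos_nneg nx] := section_trichotomy cP J Cx;
    have [ny|/pos_nneg ny] := section_trichotomy cP J Cy.
  - exact: main2.
  - exact/flipr/main2.
  - exact/flipl/main2.
  - apply: flipl => //; apply: flipr => //; [exact: (subgroupV sC)|exact: main2].
move=> pu pv; have [c cE] : exists c, c = [~ u, v] by exists [~ u, v].
rewrite -cE => pc.
have [[z [pz z2c]]|minc] := pselect (exists z, section_pos P C D z /\
    section_nneg P C D (z ^- 2 * c)).
  have Cz : C z by case: pz.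
  have [m [r [ur nr rz]]] := section_division cP J pz (pos_nneg pu).
  have [k [s [vs ns sz]]] := section_division cP J pz (pos_nneg pv).
  have Czn n : C (z ^+ n) by exact: (subgroupX _ sC).
  have ncz : section_pos P C D (c^-1 * z ^+ 2).
    (* c < z^2, because v u is at least z^(m+k) and u v is less than z^(m+k+2). *)
    have -> : c^-1 * z ^+ 2 = (s^-1 * z) * (r^-1 * z) ^ (z ^+ k.+1) *
       (s ^ (z ^+ m) * r) ^ (z ^+ 2).
      have zk : z * z ^+ k = z ^+ k * z by rewrite -expgS expgSr.
      have zkm : z ^- m * z ^+ k = z ^+ k * z ^- m.
        by apply: commute_sym; apply: commuteV; apply: commuteX2; apply: commute_refl.
      have -> : (r^-1 * z) ^ (z ^+ k.+1) = z ^- k.+1 * r^-1 * z ^+ k * z ^+ 2.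
        by rewrite conjgE (expgS z 1) expg1 expgSr !gnorm -(mulgA _ z) zk !gnorm.
      rewrite cE invgR ur vs (expgSr z k) commgEl !conjgE !gnorm.
      by rewrite -(mulgA _ (z ^- m) (z ^+ k)) zkm !gnorm.
    apply: (posM_nneg cP J); first apply: (posM_nneg cP J) => //.
      exact/pos_nneg/(jump_pos J).
    by apply: (nnegJ J) => //; apply: (nnegM cP J) => //; apply: (nnegJ J).
  apply: (pos_nnegVN cP J ncz); rewrite invgM invgK.
  exact: z2c.
have Cc : C c by case: pc.
have divc w : section_nneg P C D w -> exists m r, w = c ^+ m * r /\ D r.
  move=> nw; have [m [r [wr nr rc]]] := section_division cP J pc nw.
  exists m, r; split=> //; case: (nnegE nr) => // pr; case: minc.
  (* Of two factors of c, the smaller one has a square that is at most c. *)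
  have halves p q : section_pos P C D p -> section_pos P C D q -> c = p * q ->
      section_nneg P C D (q^-1 * p) -> exists z, section_pos P C D z /\
      section_nneg P C D (z ^- 2 * c).
    move=> pp pq cpq qp; exists q; split=> //.
    have -> : q ^- 2 * c = (q^-1 * p) ^ q by rewrite cpq !conjgE expgS expg1 !gnorm.
    by apply: (nnegJ J) => //; case: pq.
  have crq : c = r * (r^-1 * c) by rewrite mulVKg.
  have Cq : C ((r^-1 * c)^-1 * r).
    have [_ Cr _] := pr; have [_ Crc _] := rc.
    exact: (subgroupM sC (subgroupV sC Crc) Cr).
  have [nq|pq] := section_trichotomy cP J Cq; first exact: halves pr rc crq nq.
  have crq' : c = (r^-1 * c) ^ r^-1 * r by rewrite conjgE !gnorm.
  apply: (halves _ _ _ pr crq').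
    by apply: (jump_pos J) => //; apply: (subgroupV sC); case: pr.
  have -> : r^-1 * (r^-1 * c) ^ r^-1 = ((r^-1 * c)^-1 * r)^-1 ^ r^-1.
    by rewrite !conjgE !gnorm.
  by apply: (nnegJ J); [apply: (subgroupV sC); case: pr|exact: pos_nneg].
have [m [r [ur Dr]]] := divc u (pos_nneg pu).
have [k [s [vs Ds]]] := divc v (pos_nneg pv).
have gen z : C z -> D [~ z ^+ m * r, z ^+ k * s].
  move=> Cz; have zmk : z ^- k * z ^+ m = z ^+ m * z ^- k.
    by apply: commute_sym; apply: commuteV; apply: commuteX2; apply: commute_refl.
  have -> : [~ z ^+ m * r, z ^+ k * s] =
      (s ^ (z ^+ m) * r)^-1 * (r ^ (z ^+ k) * s).
    by rewrite commgEl !conjgE !gnorm -(mulgA _ (z ^- k) (z ^+ m)) zmk !gnorm.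
  have Cn n : C (z ^+ n) by exact: (subgroupX _ sC).
  apply: (subgroupM sD); first apply: (subgroupV sD).
    by apply: (subgroupM sD) => //; apply: (jump_normal J).
  by apply: (subgroupM sD) => //; apply: (jump_normal J).
by have [_ _] := pc; apply; rewrite cE ur vs; apply: gen.
Qed.

End Jumps.

(** * Orders on a section *)

(** The positive part of a C-invariant order on the coset space C/N; that it
    is a union of cosets of N follows from the axioms. *)
Record is_section_cone (G : groupType) (C N R : set G) : Prop := {
  section_coneS : R `<=` C;
  section_coneN : forall x, R x -> ~ N x;
  section_coneM : forall x y, R x -> R y -> R (x * y);
  section_coneT : forall x, C x -> N x \/ R x \/ R x^-1
}.

Section Glue.
Variable G : groupType.
Implicit Types (P C N R : set G) (x y : G).

Definition glue P C N R : set G := [set x | R x \/ (P x /\ (N x \/ ~ C x))].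

Lemma glue_cone P C N R : is_cone P -> is_convex P C -> is_subgroup N ->
  N `<=` C -> is_section_cone C N R -> is_cone (glue P C N R).
Proof.
move=> cP vC sN NC [RC RN RM RT].
have RNM x y : R x -> N y -> R (x * y) /\ R (y * x).
  move=> Rx Ny; have Cx := RC _ Rx; have Cy := NC _ Ny; split.
    have [|[//|RV]] := RT (x * y) (subgroupM vC Cx Cy).
      by rewrite (subgroupMr _ sN) // => /(RN _ Rx).
    have := RM _ _ RV Rx; rewrite !gnorm => /RN.
    by rewrite (subgroupVE _ sN).
  have [|[//|RV]] := RT (y * x) (subgroupM vC Cy Cx).
    by rewrite (subgroupMl _ sN) // => /(RN _ Rx).
  have := RM _ _ Rx RV; rewrite !gnorm => /RN.
  by rewrite (subgroupVE _ sN).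
split=> [[R1|[P1 _]]|x y Qx Qy|x].
- by apply: RN R1 _; apply: (subgroup1 sN).
- exact: (coneN1 cP).
- case: Qx => [Rx|[Px NCx]]; case: Qy => [Ry|[Py NCy]].
  + by left; apply: RM.
  + case: NCy => [Ny|nCy]; first by left; have [] := RNM _ _ Rx Ny.
    right; have Cx := RC _ Rx; split; first exact: (convexMl cP vC).
    by right; rewrite (subgroupMl _ vC).
  + case: NCx => [Nx|nCx]; first by left; have [] := RNM _ _ Ry Nx.
    right; have Cy := RC _ Ry; split; first exact: (convexMr cP vC).
    by right; rewrite (subgroupMr _ vC).
  right; split; first exact: (coneM cP).
  case: NCx NCy => [Nx|nCx] [Ny|nCy].
  + by left; apply: (subgroupM sN).
  + by right; rewrite (subgroupMl _ vC) //; apply: NC.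
  + by right; rewrite (subgroupMr _ vC) //; apply: NC.
  + right=> Cxy; apply: nCx; apply: (convexP vC Px _ Cxy).
    by rewrite mulKg.
have [Cx|nCx] := pselect (C x).
  have [Nx|[Rx|RVx]] := RT x Cx; last by right; right; left.
    have [x1|[Px|PVx]] := coneT cP x; first by left.
      by right; left; right; split=> //; left.
    by right; right; right; split=> //; left; rewrite (subgroupVE _ sN).
  by right; left; left.
have [x1|[Px|PVx]] := coneT cP x; first by left.
  by right; left; right; split=> //; right.
by right; right; right; split=> //; right; rewrite (subgroupVE _ vC).
Qed.

End Glue.

(** The quotient C/N as an additive group, so that the algebra of [zmodType] is
    available; its elements are the cosets of N. *)
Lemma abelian_quotient (G : groupType) (C N : set G) :
  is_subgroup C -> is_subgroup N -> N `<=` C ->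
  (forall x y, C x -> C y -> N [~ x, y]) ->
  exists (A : zmodType) (p : G -> A), [/\
    forall x y, C x -> C y -> p (x * y) = (p x + p y)%R,
    forall x, C x -> p x = 0%R <-> N x &
    forall a, exists2 x, C x & p x = a].
Proof.
move=> sC sN NC comm.
pose coset (x : G) : set G := [set y | N (x^-1 * y)].
have cosetP x y : coset x = coset y <-> N (x^-1 * y).
  split=> [xy|Nxy]; first by change (coset x y); rewrite xy /coset /= mulVg; apply: (subgroup1 sN).
  apply/seteqP; split=> z; rewrite /coset /=.
    have -> : y^-1 * z = (x^-1 * y)^-1 * (x^-1 * z) by rewrite !gnorm.
    by apply: (subgroupM sN); apply: (subgroupV sN).
  have -> : x^-1 * z = (x^-1 * y) * (y^-1 * z) by rewrite !gnorm.
  by apply: (subgroupM sN).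
pose A := {S : set G | `[< exists2 x, C x & S = coset x >]}.
have mkP x : `[< exists2 y, C y & coset (if `[< C x >] then x else 1) = coset y >].
  apply/asboolP; case: asboolP => [Cx|_]; first by exists x.
  by exists 1 => //; apply: (subgroup1 sC).
(* Elements outside C are sent to the class of 1, which makes p total. *)
pose p x : A := exist _ (coset (if `[< C x >] then x else 1)) (mkP x).
have psurj a : exists x, C x /\ p x = a.
  case: a => S /[dup] SP; move/asboolP: (SP) => [x Cx Sx]; move=> SP'; exists x; split=> //.
  by apply: val_inj; rewrite /= Sx; case: asboolP.
have [rep repP] := choice psurj.
have pP x y : C x -> C y -> p x = p y <-> N (x^-1 * y).
  move=> Cx Cy; rewrite -cosetP; split=> [/(congr1 val)|xy].
    by rewrite /=; do 2!case: asboolP => // _.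
  by apply: val_inj => /=; do 2!case: asboolP => // _.
pose add a b := p (rep a * rep b).
pose opp a := p (rep a)^-1.
have Crep a : C (rep a) by case: (repP a).
have prep a : p (rep a) = a by case: (repP a).
have addE x y : C x -> C y -> add (p x) (p y) = p (x * y).
  move=> Cx Cy; apply/pP; [exact: (subgroupM sC)|exact: (subgroupM sC)|].
  have /pP : p (rep (p x)) = p x by []. move=> /(_ (Crep _) Cx).
  have /pP : p (rep (p y)) = p y by []. move=> /(_ (Crep _) Cy).
  move: (rep (p x)) (rep (p y)) (Crep (p x)) (Crep (p y)) => u v Cu Cv Nv Nu.
  have -> : (u * v)^-1 * (x * y) = (v^-1 * y) * (u^-1 * x) * [~ u^-1 * x, y].
    by rewrite commgEl !conjgE !gnorm.
  apply: (subgroupM sN); first exact: (subgroupM sN).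
  by apply: comm => //; apply: (subgroupM sC) => //; apply: (subgroupV sC).
have C1 := subgroup1 sC.
have addA : associative add.
  move=> a b c; rewrite -(prep a) -(prep b) -(prep c) !addE ?mulgA //; exact: (subgroupM sC).
have addC : commutative add.
  move=> a b; apply/pP; [exact: (subgroupM sC)|exact: (subgroupM sC)|].
  by rewrite invgM -mulgA; apply: comm.
have add0 : left_id (p 1) add.
  by move=> a; rewrite -(prep a) addE // mul1g.
have addN : left_inverse (p 1) opp add.
  move=> a; rewrite -{2}(prep a) addE ?mulVg //; exact: (subgroupV sC).
pose Z := GRing.isZmodule.Build A addA addC add0 addN.
pose AZ : zmodType := HB.pack A Z.
exists AZ, p; split.
- by move=> x y Cx Cy; rewrite -addE.
- move=> x Cx; have := pP 1 x C1 Cx; rewrite invg1 mul1g => <-; split; exact: esym.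
- by move=> a; exists (rep a).
Qed.

(** * Abelian sections of rank two *)

Section Pointed.
Import GRing.Theory.
Local Open Scope ring_scope.
Variable A : zmodType.
Implicit Types (W X : set A) (a b u v : A).

(** The nonnegative elements of a partial order that is compatible with the
    addition. *)
Record is_pointed W : Prop := {
  pointed0 : W 0;
  pointedD : forall a b, W a -> W b -> W (a + b);
  pointedN : forall a, W a -> W (- a) -> a = 0
}.

Lemma pointedMn W a n : is_pointed W -> W a -> W (a *+ n).
Proof.
move=> pW Wa; elim: n => [|n IHn]; first by rewrite mulr0n; apply: pointed0.
by rewrite mulrS; apply: pointedD.
Qed.

Definition adjoin W a : set A := [set b | exists n, W (b - a *+ n)].

Lemma adjoin_pointed W a : is_pointed W ->
  (forall n, ~ W (- (a *+ n.+1))) -> is_pointed (adjoin W a).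
Proof.
move=> pW nWa; split=> [|b c [m Wb] [n Wc]|b [m Wb] [n Wb']].
- by exists 0%N; rewrite mulr0n subr0; apply: pointed0.
- exists (m + n)%N; have := pointedD pW Wb Wc.
  by rewrite mulrnDr opprD addrACA.
- have := pointedD pW Wb Wb'.
  rewrite addrACA subrr add0r -opprD -mulrnDr.
  case mn : (m + n)%N => [|k]; last by move=> /nWa.
  move: Wb Wb'; have [-> ->] : m = 0%N /\ n = 0%N by lia.
  by rewrite mulr0n !subr0 => Wb Wb' _; apply: (pointedN pW).
Qed.

(** A maximal pointed submonoid W is total: if neither a nor - a can be adjoined
    to W, then W contains - m a and n a for some positive m and n, so that m n a
    and its opposite lie in W and a is a torsion element. *)
Lemma pointed_extends W0 :
  (forall a n, a *+ n.+1 = 0 -> a = 0) -> is_pointed W0 ->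
  exists W, [/\ is_pointed W, W0 `<=` W & forall a, W a \/ W (- a)].
Proof.
(* Zorn's lemma is applied to the sets that can be added to W0, so that the empty
   chain is bounded as well. *)
move=> tf pW0; pose good X := is_pointed (W0 `|` X).
have [F FP Ftot|X [pX Xmax]] := @Zorn_bigcup _ good.
  have two a b : (W0 `|` \bigcup_(X in F) X) a -> (W0 `|` \bigcup_(X in F) X) b ->
      exists X, [/\ is_pointed (W0 `|` X), W0 `|` X `<=` W0 `|` \bigcup_(X in F) X,
        (W0 `|` X) a & (W0 `|` X) b].
    have sub X : F X -> W0 `|` X `<=` W0 `|` \bigcup_(X in F) X.
      by move=> FX c [|Xc]; [left|right; exists X].
    move=> [Wa|[X FX Xa]] [Wb|[Y FY Yb]].
    - exists set0; rewrite setU0; split=> //; by left.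
    - by exists Y; split; [exact: FP|exact: sub|left|right].
    - by exists X; split; [exact: FP|exact: sub|right|left].
    - have [XY|YX] := Ftot _ _ FX FY.
        by exists Y; split; [exact: FP|exact: sub|right; apply: XY|right].
      by exists X; split; [exact: FP|exact: sub|right|right; apply: YX].
  split=> [|a b Wa Wb|a Wa WNa].
  - by left; apply: pointed0.
  - by have [X [pX Xsub Xa Xb]] := two _ _ Wa Wb; apply/Xsub/(pointedD pX).
  - by have [X [pX _ Xa Xb]] := two _ _ Wa WNa; apply: (pointedN pX).
exists (W0 `|` X); split=> // a.
set W := W0 `|` X in pX *.
have ext b : (forall n, ~ W (- (b *+ n.+1))) -> W b.
  move=> nb; apply: contrapT => nWb.
  have sub : W `<=` adjoin W b by move=> c Wc; exists 0%N; rewrite mulr0n subr0.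
  apply: (Xmax (adjoin W b)).
    split; first by move=> c Xc; apply: sub; right.
    move=> /(_ b) Xb; apply: nWb; right; apply: Xb.
    by exists 1%N; rewrite mulr1n subrr; apply: pointed0.
  rewrite /good; suff -> : W0 `|` adjoin W b = adjoin W b by exact: adjoin_pointed.
  by apply/setUidPr => c W0c; apply: sub; left.
have [/ext|/existsNP[m /contrapT Wm]] := pselect (forall n, ~ W (- (a *+ n.+1))); first by left.
have [/ext|/existsNP[n /contrapT Wn]] := pselect (forall n, ~ W (- (- a *+ n.+1))); first by right.
left; suff -> : a = 0 by apply: pointed0.
apply: (tf _ (m * n + m + n)%N).
have -> : (m * n + m + n).+1 = (m.+1 * n.+1)%N by lia.
apply: (pointedN pX).
  rewrite mulnC mulrnA; move: Wn; rewrite mulNrn opprK => Wn.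
  by rewrite -mulrnA mulnC mulnC mulrnA; apply: pointedMn.
by rewrite mulrnA -mulNrn; apply: pointedMn.
Qed.

(** The submonoids generated by pairs of independent elements are nested as in
    the Stern-Brocot tree. From (u, v) one can pass to (v - u, u) or to
    (u - v, v), and this choice decides the sign of u - v; at step n it is made
    against e n. The union of the chain is an order on the group generated by u0
    and v0 that differs from all the e n. *)
Lemma slope_diagonal (e : nat -> set A) u0 v0 :
  (forall a b : int, u0 *~ a + v0 *~ b = 0 -> a = 0 /\ b = 0) ->
  exists2 W, is_pointed W &
    forall n, exists2 z, z <> 0 & (W z /\ ~ e n z) \/ (W (- z) /\ e n z).
Proof.
move=> indep0.
pose I (t : A * A) := forall i j : int, t.1 *~ i + t.2 *~ j = 0 -> i = 0 /\ j = 0.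
pose gen (t : A * A) : set A :=
  [set z | exists i : nat, exists j : nat, z = t.1 *+ i + t.2 *+ j].
pose r n (t t' : A * A) := [/\ gen t' t.1, gen t' t.2 &
  exists2 z, z <> 0 & (gen t' z /\ ~ e n z) \/ (gen t' (- z) /\ e n z)].
have genl t : gen t t.1 by exists 1%N, 0%N; rewrite mulr1n mulr0n addr0.
have genr t : gen t t.2 by exists 0%N, 1%N; rewrite mulr1n mulr0n add0r.
have gen0 t : gen t 0 by exists 0%N, 0%N; rewrite !mulr0n addr0.
have genD t a b : gen t a -> gen t b -> gen t (a + b).
  move=> [m [n ->]] [p [q ->]]; exists (m + p)%N, (n + q)%N.
  by rewrite !mulrnDr addrACA.
have genMn t a n : gen t a -> gen t (a *+ n).
  move=> ga; elim: n => [|n IHn]; first by rewrite mulr0n.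
  by rewrite mulrS; apply: genD.
have genN t a : I t -> gen t a -> gen t (- a) -> a = 0.
  move=> It [m [n am]] [p [q ap]].
  have [] := It (m + p)%N%:Z (n + q)%N%:Z.
    have : a + - a = 0 by rewrite subrr.
    by rewrite {1}am ap addrACA -!mulrnDr -!pmulrn.
  move=> mp nq; have [m0 n0] : m = 0%N /\ n = 0%N by lia.
  by rewrite am m0 n0 !mulr0n addr0.
have [n [u v] /= It|s s0 sP] := @dependent_sequence _ I r (u0, v0) indep0.
  have uv0 : u - v <> 0.
    move=> uv; have [] := It 1 (-1); last by [].
    by rewrite /= mulr1z mulrN1z.
  have [ez|nez] := pselect (e n (u - v)).
    exists (v - u, u).
      move=> i j; rewrite /= => ij; have [] := It (j - i) i; last by lia.
      by rewrite /= -ij mulrzBr mulrzBl addrC (addrC (u *~ j)) addrA.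
    have gu : gen (v - u, u) u by apply: (genr (v - u, u)).
    have gvu : gen (v - u, u) (v - u) by apply: (genl (v - u, u)).
    split=> //; first by have := genD _ _ _ gvu gu; rewrite subrK.
    by exists (u - v) => //; right; rewrite opprB.
  exists (u - v, v).
    move=> i j; rewrite /= => ij; have [] := It i (j - i); last by lia.
    by rewrite /= -ij mulrzBr mulrzBl (addrC (v *~ j)) addrA.
  have gv : gen (u - v, v) v by apply: (genr (u - v, v)).
  have guv : gen (u - v, v) (u - v) by apply: (genl (u - v, v)).
  split=> //; first by have := genD _ _ _ guv gv; rewrite subrK.
  by exists (u - v) => //; left.
have mono m n : gen (s m) `<=` gen (s (m + n)%N).
  elim: n => [|n IHn]; first by rewrite addn0.
  move=> z /IHn[i [j ->]]; rewrite addnS; have [_ [g1 g2 _]] := sP (m + n)%N.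
  by apply: genD; apply: genMn.
exists (\bigcup_n gen (s n)).
  split=> [|a b [m _ ga] [n _ gb]|a [m _ ga] [n _ gb]]; first by exists 0%N.
    exists (m + n)%N => //; apply: genD; first exact: mono.
    by rewrite addnC; apply: mono.
  have [Imn _] := sP (m + n)%N.
  by apply: (genN _ _ Imn); [apply: mono|rewrite addnC; apply: mono].
move=> n; have [_ [_ _ [z z0 zP]]] := sP n; exists z => //.
by case: zP => [[gz ez]|[gz ez]]; [left|right]; split=> //; exists n.+1.
Qed.

End Pointed.

(** C/N is a torsion-free abelian group with two independent elements. The
    order of [slope_diagonal] on the subgroup that they generate extends to C/N
    and glues with P to a cone of G that e misses. *)
Lemma rank_two_section (G : groupType) (e : nat -> set G) (P C N : set G) (x y : G) :
  enumerates e -> is_cone P -> is_convex P C -> is_subgroup N -> N `<=` C ->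
  (forall u v, C u -> C v -> N [~ u, v]) ->
  (forall u n, C u -> N (u ^+ n.+1) -> N u) ->
  C x -> C y ->
  (forall m n, N (x ^+ m * y ^+ n) \/ N (x ^+ m * y ^- n) -> m = 0%N /\ n = 0%N) ->
  False.
Proof.
move=> eP cP vC sN NC comm tf Cx Cy indep.
have [A [p [pM pN psurj]]] := abelian_quotient vC sN NC comm.
have C1 := subgroup1 vC.
have p1 : p 1 = 0%R by apply/(pN 1 C1); apply: (subgroup1 sN).
have pV u : C u -> p u^-1 = (- p u)%R.
  move=> Cu; apply/eqP; rewrite -GRing.addr_eq0 -pM ?mulVg ?p1 //.
  exact: (subgroupV vC).
have CX u n : C u -> C (u ^+ n) by exact: (subgroupX _ vC).
have pX u n : C u -> p (u ^+ n) = (p u *+ n)%R.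
  move=> Cu; elim: n => [|n IHn]; first by rewrite p1.
  by rewrite expgS pM ?IHn ?GRing.mulrS //; apply: CX.
have CV u : C u -> C u^-1 by exact: (subgroupV vC).
have tfA (a : A) n : (a *+ n.+1 = 0)%R -> (a = 0)%R.
  have [u Cu <-] := psurj a; rewrite -pX // => /(pN _ (CX u _ Cu))/(tf _ _ Cu) Nu.
  exact/(pN u Cu).
have indepA (i j : int) : (p x *~ i + p y *~ j = 0)%R -> (i = 0 /\ j = 0)%R.
  have pos m n : (p x *+ m + p y *+ n = 0)%R -> m = 0%N /\ n = 0%N.
    rewrite -!pX // -pM; [|exact: CX|exact: CX].
    move=> /(pN _ (subgroupM vC (CX _ _ Cx) (CX _ _ Cy))) Nxy.
    by apply: indep; left.
  have neg m n : (p x *+ m - p y *+ n = 0)%R -> m = 0%N /\ n = 0%N.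
    rewrite -!pX // -pV; last exact: CX.
    rewrite -pM; [|exact: CX|exact/CV/CX].
    move=> /(pN _ (subgroupM vC (CX _ _ Cx) (CV _ (CX _ _ Cy)))) Nxy.
    by apply: indep; right.
  case: i => i; case: j => j.
  - by rewrite -!pmulrn => /pos[-> ->].
  - by rewrite NegzE mulrNz -!pmulrn => /neg[].
  - rewrite NegzE mulrNz -!pmulrn => /eqP.
    by rewrite GRing.addrC -GRing.oppr_eq0 GRing.opprB => /eqP/neg[].
  - rewrite !NegzE !mulrNz -!pmulrn -GRing.opprD => /eqP.
    by rewrite GRing.oppr_eq0 => /eqP/pos[].
pose eA n : set A := [set a | exists u, [/\ C u, p u = a & e n u]].
have [W0 pW0 W0e] := slope_diagonal eA indepA.
have [W [pW W0W Wtot]] := pointed_extends tfA pW0.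
pose R : set G := [set u | [/\ C u, p u <> 0%R & W (p u)]].
have RP : is_section_cone C N R.
  split=> [u []//|u [Cu pu0 _] Nu|u v [Cu pu0 Wu] [Cv pv0 Wv]|u Cu].
  - exact/pu0/(pN u Cu).
  - split; [exact: (subgroupM vC)| |rewrite pM //; exact: (pointedD pW)].
    rewrite pM // => uv0; apply: pu0; apply: (pointedN pW) => //.
    by have <- : p v = (- p u)%R by apply/eqP; rewrite -GRing.addr_eq0 GRing.addrC uv0.
  - have [pu|pu] := pselect (p u = 0%R); first by left; apply/(pN u Cu).
    right; have [Wu|Wu] := Wtot (p u); [by left|right].
    split; [exact: CV|rewrite pV // => /eqP|by rewrite pV].
    by rewrite GRing.oppr_eq0 => /eqP.
have [n en] := eP _ (glue_cone cP vC sN NC RP).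
have [z z0 [[/W0W Wz nez]|[/W0W Wz [u [Cu uz]]]]] := W0e n.
  have [u Cu uz] := psurj z; apply: nez; exists u; split=> //; rewrite en; left.
  by rewrite /R /= uz.
rewrite en => -[[_ _ Wu]|[_ [/(pN u Cu)|//]]]; last by rewrite uz.
by apply: z0; apply: (pointedN pW) => //; rewrite -uz.
Qed.

(** * Sections that act by affine maps *)

Section Affine.
Variable G : groupType.
Implicit Types (P C D E : set G) (x y z g c : G).

(** Conjugation x |-> g x g^-1 enlarges the positive elements of C/D. *)
Definition expands P C D g :=
  forall x, section_pos P C D x -> section_pos P C D (x^-1 * x ^ g^-1).

(** With d = x^-1 (g x g^-1), each conjugation by g multiplies the iterate of x
    by a conjugate of d which is at least d, so that the n-th iterate is at
    least d^n. *)
Lemma expands_unbounded P C D g x y : is_cone P -> is_jump P C D ->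
  (forall z, section_pos P C D z -> section_pos P C D (z ^ g^-1)) ->
  expands P C D g -> section_pos P C D x -> C y ->
  exists n, section_nneg P C D (y^-1 * x ^ (g ^- n)).
Proof.
move=> cP J inv ex px Cy; pose d := x^-1 * x ^ g^-1.
have pd : section_pos P C D d by apply: ex.
have invn z n : section_pos P C D z -> section_pos P C D (z ^ (g ^- n)).
  move=> pz; elim: n => [|n IHn]; first by rewrite expg0 invg1 conjg1.
  by rewrite expgS invgM conjgM; apply: inv.
have dn n : section_nneg P C D (d^-1 * d ^ (g ^- n)).
  elim: n => [|n IHn]; first by rewrite expg0 invg1 conjg1 mulVg; apply: nneg1.
  have := nnegM cP J IHn (pos_nneg (ex _ (invn d n pd))).
  by rewrite -conjgM -invgM -expgS -mulgA mulVKg.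
have xn n : section_nneg P C D (d ^- n * x ^ (g ^- n)).
  elim: n => [|n IHn]; first by rewrite !expg0 invg1 conjg1 mul1g; apply: pos_nneg.
  have -> : d ^- n.+1 * x ^ (g ^- n.+1) =
      (d^-1 * d ^ (g ^- n)) * (d ^- n * x ^ (g ^- n)) ^ (d ^ (g ^- n)).
    have -> : x ^ (g ^- n.+1) = x ^ (g ^- n) * d ^ (g ^- n).
      by rewrite -conjMg mulVKg -conjgM -invgM -expgSr.
    by rewrite expgSr !conjgE !gnorm.
  apply: (nnegM cP J) => //; apply: (nnegJ J) => //.
  by have [_] := invn d n pd.
have [n dny] := jump_arch J pd Cy; exists n.+1.
have Cdn : C (d ^+ n.+1) by apply: (subgroupX _ (jump_upper J)); case: pd.
rewrite -(mulVKg (d ^+ n.+1) (x ^ _)) mulgA; apply: (nnegM cP J) => //.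
split; last by right.
by apply: (subgroupM (jump_upper J)) => //; apply: (subgroupV (jump_upper J)).
Qed.

Lemma nat_switch (Q : nat -> Prop) n : ~ Q 0 -> Q n -> exists k, ~ Q k /\ Q k.+1.
Proof.
elim: n => [//|n IHn] nQ0 Qn1; have [Qn|nQn] := pselect (Q n); first exact: IHn.
by exists n.
Qed.

(** E acts by conjugation on the coset tC, which is a totally ordered set modulo
    D: C acts by translations, and each t m acts as an expanding affine map with
    fixed point m, where C is identified with tC by c |-> t c. For a cut S of C, the
    elements of E that move S upwards are the positive elements of an order on the
    cosets of the stabilizer of S, and t m is positive when m is in S and
    negative when m is above S. Nested intervals produce a cut for which the
    sign of some t m differs from that of e n, for every n. *)
Lemma affine_section (e : nat -> set G) P E C D t :
  enumerates e -> is_cone P -> is_jump P C D -> is_jump P E C ->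
  (forall x g, E g -> D x -> D (x ^ g)) ->
  (forall x g, E g -> section_pos P C D x -> section_pos P C D (x ^ g)) ->
  E t -> expands P C D t -> False.
Proof.
move=> eP cP J1 J2 normE posE Et ext.
have sE := jump_upper J2; have sC := jump_upper J1; have sD := jump_lower J1.
have CE := jump_sub J2; have DC := jump_sub J1.
(* t (act g c) is the conjugate g (t c) g^-1. *)
pose act g c := t^-1 * g * t * c * g^-1.
have actM g h c : act (g * h) c = act g (act h c) by rewrite /act !gnorm.
have act1 c : act 1 c = c by rewrite /act !gnorm.
have actK g c : act g^-1 (act g c) = c by rewrite -actM mulVg act1.
have actC g c : E g -> C c -> C (act g c).
  move=> Eg Cc; have -> : act g c = [~ t, g^-1] * c ^ g^-1.
    by rewrite /act commgEl !conjgE !gnorm.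
  apply: (subgroupM sC); last by apply: (jump_normal J2) => //; apply: (subgroupV sE).
  by apply: (jump_comm cP J2) => //; apply: (subgroupV sE).
pose lt c c' := section_pos P C D (c^-1 * c').
pose le c c' := section_nneg P C D (c^-1 * c').
have lt_le c c' : lt c c' -> le c c' by apply: pos_nneg.
have le_refl c : le c c by rewrite /le mulVg; apply: nneg1.
have le_trans a b c : le a b -> le b c -> le a c.
  by move=> ab bc; have := nnegM cP J1 ab bc; rewrite -mulgA mulVKg.
have le_lt a b c : le a b -> lt b c -> lt a c.
  by move=> ab bc; have := nnegM_pos cP J1 ab bc; rewrite -mulgA mulVKg.
have lt_leN a b : lt a b -> ~ le b a.
  by move=> ab; have := pos_nnegVN cP J1 ab; rewrite invgM invgK.
have lt_total a b : C a -> C b -> lt a b \/ le b a.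
  move=> Ca Cb; have Cba : C (b^-1 * a).
    by apply: (subgroupM sC) => //; apply: (subgroupV sC).
  by have [|] := section_trichotomy cP J1 Cba; [right|rewrite invgM invgK; left].
have lt_act g c c' : E g -> lt c c' -> lt (act g c) (act g c').
  move=> Eg cc'; rewrite /lt; have -> : (act g c)^-1 * act g c' = (c^-1 * c') ^ g^-1.
    by rewrite /act conjgE !gnorm.
  by apply: posE => //; apply: (subgroupV sE).
have dense a b : C a -> lt a b -> exists m, [/\ C m, lt a m & lt m b].
  move=> Ca ab; have pab := posE _ _ Et ab; exists (a * (a^-1 * b) ^ t); split.
  - by apply: (subgroupM sC) => //; case: pab.
  - by rewrite /lt mulKg.
  - by have := ext _ pab; rewrite conjgK /lt (invgM a) -!mulgA.
have CM a b : C a -> lt a b -> C b.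
  by move=> Ca [_ + _]; rewrite (subgroupMl _ sC) //; apply: (subgroupV sC).
have [a0 [b0 [Ca0 ab0]]] : exists a b, C a /\ lt a b.
  have [c [Cc nDc]] := jump_neq J1; have C1 := subgroup1 sC.
  have [lt1c|[_ [|Pc]]] := lt_total _ _ C1 Cc; first by exists 1, c.
    by rewrite mulg1 (subgroupVE _ sD).
  exists 1, c^-1; split=> //; rewrite /lt invg1 mul1g; split; last by rewrite (subgroupVE _ sD).
    by rewrite mulg1 in Pc.
  exact: (subgroupV sC).
(* The next interval lies below m if e n contains t m, and above m otherwise. *)
pose I (s : G * G) := C s.1 /\ lt s.1 s.2.
pose r n (s s' : G * G) := [/\ lt s.1 s'.1, lt s'.2 s.2 & exists2 m, C m &
   (e n (t * m) /\ lt s'.2 m) \/ (~ e n (t * m) /\ lt m s'.1)].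
have [|n [a b] /= [Ca ab]|s _ sP] := @dependent_sequence _ I r (a0, b0).
- by [].
- have [m [Cm am mb]] := dense _ _ Ca ab.
  have [en|nen] := pselect (e n (t * m)).
    have [b' [Cb' ab' b'm]] := dense _ _ Ca am.
    have [a' [Ca' aa' a'b']] := dense _ _ Ca ab'.
    exists (a', b') => //; split=> //=; last by exists m => //; left.
    exact: le_lt (lt_le _ _ b'm) mb.
  have [a' [Ca' ma' a'b]] := dense _ _ Cm mb.
  have [b' [Cb' a'b' b'b]] := dense _ _ Ca' a'b.
  exists (a', b') => //; split=> //=; last by exists m => //; right.
  exact: le_lt (lt_le _ _ am) ma'.
have Cs1 n : C (s n).1 by have [[]] := sP n.
have Cs2 n : C (s n).2 by have [[Ca /(CM _ _ Ca)]] := sP n.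
have s1mono n k : le (s n).1 (s (n + k)%N).1.
  elim: k => [|k IHk]; first by rewrite addn0.
  by rewrite addnS; apply: le_trans IHk _; have [_ [/lt_le]] := sP (n + k)%N.
have s2mono n k : le (s (n + k)%N).2 (s n).2.
  elim: k => [|k IHk]; first by rewrite addn0.
  by rewrite addnS; apply: le_trans _ IHk; have [_ [_ /lt_le]] := sP (n + k)%N.
pose S : set G := [set c | C c /\ exists n, lt c (s n).1].
have S_down c c' : C c' -> le c' c -> S c -> S c'.
  by move=> Cc' c'c [Cc [n cn]]; split=> //; exists n; apply: le_lt c'c cn.
have S1 n : S (s n).1.
  by split=> //; exists n.+1; have [_ []] := sP n.
have nS2 n : ~ S (s n).2.
  move=> [_ [k]] /lt_leN; apply; have [[_ /lt_le lt_kn] _] := sP (k + n)%N.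
  apply: le_trans (s1mono k n) (le_trans _ _ _ lt_kn _).
  by rewrite addnC; apply: s2mono.
have S_lt c c' : C c' -> S c -> ~ S c' -> lt c c'.
  move=> Cc' Sc nSc'; have [//|c'c] := lt_total _ _ Sc.1 Cc'.
  by case: nSc'; apply: S_down c'c Sc.
pose up g := exists c, S c /\ ~ S (act g c).
pose R : set G := [set g | E g /\ up g].
pose N : set G := [set g | [/\ E g, ~ up g & ~ up g^-1]].
have NE : N `<=` E by move=> g [].
have upM g h : E g -> E h -> ~ up g -> ~ up h -> ~ up (g * h).
  move=> Eg Eh ng nh [c [Sc]]; rewrite actM => nS.
  have [Sh|nSh] := pselect (S (act h c)); first by apply: ng; exists (act h c).
  by apply: nh; exists c.
have up1 : ~ up 1 by move=> [c []]; rewrite act1.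
have sN : is_subgroup N.
  split=> [|g h [Eg ng ngV] [Eh nh nhV]|g [Eg ng ngV]].
  - by split; rewrite ?invg1 //; apply: (subgroup1 sE).
  - split; [exact: (subgroupM sE)|exact: upM|].
    by rewrite invgM; apply: upM => //; apply: (subgroupV sE).
  - by split; rewrite ?invgK //; apply: (subgroupV sE).
have RP : is_section_cone E N R.
  split=> [g []//|g [_ ug] [_ /(_ ug)]//|g h [Eg [c' [Sc' nSc']]] [Eh [c [Sc nSc]]]|g Eg].
  - split; first exact: (subgroupM sE).
    exists c; split=> //; rewrite actM => nS; apply: nSc'.
    have c'hc := S_lt _ _ (actC _ _ Eh Sc.1) Sc' nSc.
    apply: S_down nS; first by apply: actC => //; case: Sc'.
    exact/lt_le/lt_act.
  - have [ug|nug] := pselect (up g); first by right; left.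
    have [ugV|nugV] := pselect (up g^-1); last by left.
    by right; right; split=> //; apply: (subgroupV sE).
have cQ := glue_cone cP sE sN NE RP.
have [n en] := eP _ cQ.
have [_ [_ _ [m Cm mP]]] := sP n.
pose g := t * m.
have Eg : E g by apply: (subgroupM sE) => //; apply: CE.
have actg x k : act (g ^+ k) (m * x) = m * x ^ (g ^- k).
  have : m = t^-1 * g by rewrite mulKg.
  rewrite /act; move: g {Eg} => h ->.
  have hk : h ^+ k * h = h * h ^+ k by rewrite -expgS -expgSr.
  by rewrite conjgE !gnorm -(mulgA _ _ h) hk !gnorm.
have extg : expands P C D g.
  move=> x px; have [_ Cx _] := px.
  pose d := [~ x, m^-1] ^ t^-1.
  have Dd : D d.
    apply: normE; first exact: (subgroupV sE).
    by apply: (jump_comm cP J1) => //; apply: (subgroupV sC).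
  have -> : x^-1 * x ^ g^-1 = x^-1 * x ^ t^-1 * d.
    by rewrite -mulgA -conjMg /g invgM conjgM; congr (_ * _ ^ _); rewrite commgEl mulVKg.
  by apply: (posM_nneg cP J1); [apply: ext|apply: lower_nneg].
have unb := expands_unbounded cP J1 _ extg.
have posg z : section_pos P C D z -> section_pos P C D (z ^ g^-1).
  by apply: posE; apply: (subgroupV sE).
(* The element g fixes m and pushes the points near m away from it; the first
   iterate on the other side of the cut shows whether g moves the cut up or
   down. *)
case: mP => -[eg ms].
  pose b := (s n.+1).2^-1 * m; have pb : section_pos P C D b by [].
  have [k bk] := unb b ((s 0%N).1^-1 * m) posg ms
    (subgroupM sC (subgroupV sC (Cs1 0%N)) Cm).
  pose y k := act (g ^+ k) (m * b^-1).
  have [k' [nS Sk]] : exists k, ~ S (y k) /\ S (y k.+1).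
    apply: (@nat_switch (fun k => S (y k)) k).
      by rewrite /y expg0 act1 /b invgM invgK mulVKg.
    apply: S_down (S1 0%N).
      apply: actC; first exact: (subgroupX _ sE).
      by apply: (subgroupM sC) => //; case: pb => _ /(subgroupV sC).
    have CB : C (b ^ (g ^- k)).
      by have [] := posE _ _ (subgroupV sE (subgroupX k sE Eg)) pb.
    have conjE B a : (m * B^-1)^-1 * a = ((a^-1 * m)^-1 * B) ^ B^-1.
      by rewrite conjgE !gnorm.
    rewrite /le /y actg conjVg conjE; apply: (nnegJ J1) => //.
    exact: (subgroupV sC).
  have : R g^-1.
    split; first exact: (subgroupV sE).
    exists (y k'.+1); split=> //; rewrite /y expgS actM actK; exact: nS.
  move: eg; rewrite en => /(coneVN cQ) nQ RgV.
  by apply: nQ; left.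
pose b := m^-1 * (s n.+1).1.
have [k bk] := unb b (m^-1 * (s 0%N).2) posg ms
  (subgroupM sC (subgroupV sC Cm) (Cs2 0%N)).
pose y k := act (g ^+ k) (m * b).
have [k' [Sk nS]] : exists k, ~ ~ S (y k) /\ ~ S (y k.+1).
  apply: (@nat_switch (fun k => ~ S (y k)) k).
    by rewrite /y expg0 act1 /b mulVKg; apply; apply: S1.
  move=> Syk; apply: (nS2 0%N); apply: S_down Syk => //.
  have mulE B a : a^-1 * (m * B) = (m^-1 * a)^-1 * B by rewrite !gnorm.
  by rewrite /le /y actg mulE.
apply: eg; rewrite en; left; split=> //.
exists (y k'); split; first exact: contrapT.
by rewrite -actM -expgS.
Qed.

End Affine.

(** * Consecutive jumps *)

Section Flips.
Variables (G : groupType) (e : nat -> set G) (P : set G).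
Hypotheses (eP : enumerates e) (cP : is_cone P).
Implicit Types (C D E : set G) (x y z g c t : G).

Lemma convex_root D x n : is_convex P D -> D (x ^+ n.+1) -> D x.
Proof.
move=> vD Dxn.
suff pos y : P y -> D (y ^+ n.+1) -> D y.
  have [->|[|PVx]] := coneT cP x; [exact: (subgroup1 vD)|by move=> /pos; apply|].
  by rewrite -(subgroupVE _ vD); apply: pos => //; rewrite expVgn; apply: (subgroupV vD).
case: n {Dxn} => [//|n] Py Dyn; apply: (convexP vD Py _ Dyn).
by rewrite expgS mulKg; apply: coneX.
Qed.

(** C/D has rank one, as otherwise [rank_two_section] applies. *)
Lemma jump_commensurable C D x y : is_jump P C D ->
  section_pos P C D x -> section_pos P C D y ->
  exists m n, D (x ^- m.+1 * y ^+ n.+1).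
Proof.
move=> J px py; apply: contrapT => ncomm.
have sC := jump_upper J; have sD := jump_lower J.
have [_ Cx nDx] := px; have [_ Cy nDy] := py.
apply: (rank_two_section eP cP (jump_upper J) (jump_lower J) (jump_sub J) _ _ Cx Cy).
- by move=> u v; apply: (jump_comm cP J).
- by move=> u n _; apply: convex_root.
have zero z n : ~ D z -> D (z ^+ n) -> n = 0%N.
  by case: n => // n nDz /(convex_root sD).
move=> [|m] [|n] //.
- by rewrite expg0 !mul1g (subgroupVE _ sD) => -[] /(zero _ _ nDy).
- by rewrite expg0 invg1 mulg1 => -[] /(zero _ _ nDx).
move=> [Dxy|Dxy].
  by have [_ _ []] := posM_nneg cP J (posX m cP J px) (pos_nneg (posX n cP J py)).
case: ncomm; exists m, n.
have -> : x ^- m.+1 * y ^+ n.+1 = ((x ^+ m.+1 * y ^- n.+1)^-1) ^ (y ^+ n.+1).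
  by rewrite conjgE !gnorm.
apply: (jump_normal J); first exact: (subgroupX _ sC).
exact: (subgroupV sD).
Qed.

Lemma pos_or_inv C D x : is_jump P C D -> C x -> ~ D x ->
  section_pos P C D x \/ section_pos P C D x^-1.
Proof.
move=> J Cx nDx; have [/nnegE[//|]|] := section_trichotomy cP J Cx; by [left|right].
Qed.

(** If D and its conjugate D' by an element of E were different, then the two
    maps from C to the rank one groups C/D and C/D' would have incomparable
    kernels, and the quotient of C by their intersection would be abelian of rank
    two. *)
Lemma lower_normal E C D t d : is_jump P C D -> is_jump P E C ->
  E t -> D d -> D (d ^ t).
Proof.
move=> J1 J2 Et Dd; apply: contrapT => nDdt.
have sE := jump_upper J2; have sC := jump_upper J1; have sD := jump_lower J1.
have CE := jump_sub J2; have DC := jump_sub J1.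
have Cd := DC _ Dd.
have CJ z : C z -> C (z ^ t) by apply: (jump_normal J2).
(* The elements d and d' will be independent modulo the intersection N of D and
   its conjugate. *)
pose N : set G := [set c | D c /\ D (c ^ t)].
have sN : is_subgroup N.
  split=> [|x y [Dx Dxt] [Dy Dyt]|x [Dx Dxt]].
  - by split; rewrite ?conj1g; apply: (subgroup1 sD).
  - by split; rewrite ?conjMg; apply: (subgroupM sD).
  - by split; rewrite ?conjVg; apply: (subgroupV sD).
have [d' [Cd' Dd't nDd']] : exists d', [/\ C d', D (d' ^ t) & ~ D d'].
  have [c [Cc nDc]] := jump_neq J1.
  have [Dct|nDct] := pselect (D (c ^ t)); first by exists c.
  have [c' [Cc' nDc' pc']] : exists c', [/\ C c', ~ D c' & section_pos P C D (c' ^ t)].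
    have [pc|pc] := pos_or_inv J1 (CJ _ Cc) nDct; first by exists c.
    exists c^-1; rewrite conjVg (subgroupVE _ sD); split=> //; exact: (subgroupV sC).
  have [b [Db pb]] : exists b, D b /\ section_pos P C D (b ^ t).
    have [pd|pd] := pos_or_inv J1 (CJ _ Cd) nDdt; first by exists d.
    by exists d^-1; rewrite conjVg (subgroupVE _ sD).
  have [m [n Dmn]] := jump_commensurable J1 pc' pb.
  exists (c' ^- m.+1 * b ^+ n.+1); split.
  - apply: (subgroupM sC); last exact: (subgroupX _ sC (DC _ Db)).
    exact: (subgroupV sC (subgroupX _ sC Cc')).
  - by rewrite conjMg conjVg !conjXg.
  - rewrite (subgroupMr _ sD); last exact: (subgroupX _ sD).
    by rewrite (subgroupVE _ sD) => /(convex_root sD).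
apply: (rank_two_section eP cP sC sN _ _ _ Cd' Cd).
- by move=> x [/DC].
- move=> u v Cu Cv; split; first exact: (jump_comm cP J1).
  by rewrite conjRg; apply: (jump_comm cP J1); apply: CJ.
- move=> u n Cu [Du Dut]; split; first exact: convex_root Du.
  by apply: (@convex_root _ _ n sD); rewrite -conjXg.
have zero z n : ~ D z -> D (z ^+ n) -> n = 0%N.
  by case: n => // n nDz /(convex_root sD).
have DX n : D (d ^+ n) by exact: (subgroupX _ sD).
move=> m n N2; have m0 : m = 0%N.
  apply: (zero _ _ nDd'); case: N2 => -[+ _]; rewrite (subgroupMr _ sD) //.
  exact: (subgroupV sD).
split=> //; move: N2; rewrite m0 expg0 !mul1g => -[] [_].
  by rewrite conjXg => /(zero _ _ nDdt).
by rewrite conjVg (subgroupVE _ sD) conjXg => /(zero _ _ nDdt).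
Qed.

(** C/D has rank one, so that conjugation by t either preserves the order or
    reverses it. *)
Lemma preserved_sign E C D t a b : is_jump P C D -> is_jump P E C -> E t ->
  section_pos P C D a -> section_pos P C D b ->
  section_pos P C D (a ^ t) -> section_pos P C D (b ^ t).
Proof.
move=> J1 J2 Et pa pb pat; have sC := jump_upper J1; have sE := jump_upper J2.
have Cbt : C (b ^ t) by apply: (jump_normal J2) => //; case: pb.
have nDbt : ~ D (b ^ t).
  move=> /(lower_normal J1 J2 (subgroupV sE Et)); rewrite conjgK.
  by case: pb.
have [//|pbV] := pos_or_inv J1 Cbt nDbt.
have [m [n Dab]] := jump_commensurable J1 pb pa.
have := lower_normal J1 J2 Et Dab; rewrite conjMg conjVg !conjXg -expVgn.
by have [_ _] := posM_nneg cP J1 (posX m cP J1 pbV) (pos_nneg (posX n cP J1 pat)).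
Qed.

(** A central extension of a group of rank one by a group of rank one is abelian,
    and here its rank is two. *)
Lemma central_section E C D : is_jump P C D -> is_jump P E C ->
  (forall t c, E t -> C c -> D [~ c, t]) -> False.
Proof.
move=> J1 J2 central; have sE := jump_upper J2; have sC := jump_upper J1.
have sD := jump_lower J1; have CE := jump_sub J2; have DC := jump_sub J1.
have DJ d t : E t -> D d -> D (d ^ t) by exact: lower_normal J1 J2.
have powM s k m : E s -> C k -> exists2 d, D d & (s * k) ^+ m = s ^+ m * k ^+ m * d.
  move=> Es Ck; elim: m => [|m [d Dd dE]].
    by exists 1; rewrite ?mulg1 //; apply: (subgroup1 sD).
  exists (([~ k ^+ m, s] * d ^ s) ^ k).
    apply: (DJ _ _ (CE _ Ck)); apply: (subgroupM sD); last exact: DJ.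
    by apply: central => //; apply: (subgroupX _ sC).
  by rewrite !expgSr dE commgEl !conjgE !gnorm.
have commV x t : E x -> D [~ x^-1, t] -> D [~ x, t].
  move=> Ex /(DJ _ _ Ex)/(subgroupV sD).
  by congr (D _); rewrite !commgEl !conjgE !gnorm.
have comm s t : E s -> E t -> D [~ s, t].
  move=> Es Et; have [Cs|nCs] := pselect (C s); first exact: central.
  have [Ct|nCt] := pselect (C t).
    by rewrite -invgR; apply: (subgroupV sD); apply: central.
  have [s' [ps' s'E]] : exists s', section_pos P E C s' /\ (s' = s \/ s' = s^-1).
    have [ps|ps] := pos_or_inv J2 Es nCs; first by exists s; split=> //; left.
    by exists s^-1; split=> //; right.
  have [t' [pt' t'E]] : exists t', section_pos P E C t' /\ commute t' t.
    have [pt|pt] := pos_or_inv J2 Et nCt; first by exists t.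
    by exists t^-1; split=> //; apply: commute_sym; apply: commuteV.
  have [m [n Cc]] := jump_commensurable J2 ps' pt'.
  set c := _ * _ in Cc.
  have sX k : E (s ^+ k) by exact: (subgroupX _ sE).
  (* A power of s' is a power of t' times an element of C, which is central
     modulo D. *)
  have Ds : D [~ s ^+ m.+1, t].
    have Ds' : D [~ s' ^+ m.+1, t].
      have s'c : s' ^+ m.+1 = t' ^+ n.+1 * c^-1 by rewrite /c !gnorm.
      have -> : [~ s' ^+ m.+1, t] = [~ c^-1, t].
        have tt : (t' ^+ n.+1) ^ t = t' ^+ n.+1.
          by apply/conjg_fixP/commgP; apply: commute_sym; apply: commuteX; apply: commute_sym.
        by rewrite s'c !commgEl conjMg tt !gnorm.
      by apply: central => //; apply: (subgroupV sC).
    case: s'E Ds' => -> //; rewrite expVgn; exact: commV.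
  have Ck : C [~ s, t] by exact: (jump_comm cP J2).
  have [d Dd dE] := powM s [~ s, t] m.+1 Es Ck.
  (* Modulo D, the commutator of s^(m+1) and t is a power of that of s and t. *)
  apply: (@convex_root _ _ m sD).
  move: Ds; rewrite commgEl conjXg.
  have -> : s ^ t = s * [~ s, t] by rewrite commgEl mulVKg.
  by rewrite dE -!mulgA mulKg (subgroupMr _ sD).
have [t [Et nCt]] := jump_neq J2; have [c [Cc nDc]] := jump_neq J1.
apply: (rank_two_section eP cP sE sD _ comm _ Et (CE _ Cc)).
- by move=> x /DC/CE.
- by move=> u n _; apply: convex_root.
have zero (H : set G) z n : is_convex P H -> ~ H z -> H (z ^+ n) -> n = 0%N.
  by case: n => // n vH nHz /(convex_root vH).
have CX n : C (c ^+ n) by exact: (subgroupX _ sC).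
move=> m n N2; have m0 : m = 0%N.
  apply: (zero C _ _ sC nCt); case: N2 => /DC; rewrite (subgroupMr _ sC) //.
  exact: (subgroupV sC).
split=> //; apply: (zero D _ _ sD nDc); move: N2; rewrite m0 expg0 !mul1g.
by rewrite (subgroupVE _ sD) => -[].
Qed.

(** If all conjugations by E preserve the order of C/D, then either E acts
    trivially on C/D and [central_section] applies, or some element moves some,
    hence by rank one every, positive element upwards and [affine_section]
    applies. *)
Lemma flip_exists E C D : is_jump P C D -> is_jump P E C ->
  exists t, section_pos P E C t /\
    forall c, section_pos P C D c -> P (c^-1 ^ t^-1).
Proof.
move=> J1 J2; have sE := jump_upper J2; have sC := jump_upper J1.
have sD := jump_lower J1.
have DJ d t : E t -> D d -> D (d ^ t) by exact: lower_normal J1 J2.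
have [[t [a [Et pa nat]]]|noflip] := pselect (exists t a,
    [/\ E t, section_pos P C D a & ~ section_pos P C D (a ^ t)]); last first.
  have posE c t : E t -> section_pos P C D c -> section_pos P C D (c ^ t).
    by move=> Et pc; apply: contrapT => nct; apply: noflip; exists t, c.
  have [[t [c [Et pc nDct]]]|central] := pselect (exists t c,
      [/\ E t, section_pos P C D c & ~ D [~ c, t]]); last first.
    exfalso; apply: (central_section J1 J2) => t c Et Cc; apply: contrapT => nDct.
    have CE := jump_sub J2.
    have [pc|pc] : section_pos P C D c \/ section_pos P C D c^-1.
    - apply: (pos_or_inv J1 Cc) => Dc; apply: nDct; rewrite commgEl.
      by apply: (subgroupM sD); [exact: (subgroupV sD)|exact: DJ].
    - by apply: central; exists t, c.
    - apply: central; exists t, c^-1; split=> // /(DJ _ _ (CE _ Cc))/(subgroupV sD) Dct.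
      apply: nDct; move: Dct.
      by congr (D _); rewrite !commgEl !conjgE !gnorm.
  have [s [Es pcs]] : exists s, E s /\ section_pos P C D (c^-1 * c ^ s).
    have Ck : C [~ c, t].
      have [_ Cc _] := pc; rewrite commgEl; apply: (subgroupM sC); first exact: (subgroupV sC).
      exact: (jump_normal J2).
    have [pk|pk] := pos_or_inv J1 Ck nDct; first by exists t; rewrite -commgEl.
    exists t^-1; split; first exact: (subgroupV sE).
    have := posE _ _ (subgroupV sE Et) pk.
    by congr (section_pos _ _ _ _); rewrite commgEl !conjgE !gnorm.
  exfalso; apply: (affine_section eP cP J1 J2 _ _ (subgroupV sE Es)).
  - by move=> x g; apply: DJ.
  - by move=> x g; apply: posE.
  move=> a pa; rewrite invgK; have [_ Ca _] := pa; have [_ Cc _] := pc.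
  have pas := posE _ _ Es pa; have [_ Cas _] := pas.
  have Caas : C (a^-1 * a ^ s) by apply: (subgroupM sC) => //; apply: (subgroupV sC).
  have powS x y n : x^-1 ^+ n.+1 * y ^+ n.+1 = (x^-1 * y) * (x^-1 ^+ n * y ^+ n) ^ y.
    by rewrite expgS expgSr !conjgE !gnorm.
  have pow_nneg x y n : C y -> section_nneg P C D (x^-1 * y) ->
      section_nneg P C D (x^-1 ^+ n * y ^+ n).
    move=> Cy nxy; elim: n => [|n IHn]; first by rewrite !expg0 mulg1; apply: nneg1.
    by rewrite powS; apply: (nnegM cP J1) => //; apply: (nnegJ J1).
  have Cacs : C (c ^ s) by apply: (jump_normal J2).
  have pow_pos n : section_pos P C D (c^-1 ^+ n.+1 * (c ^ s) ^+ n.+1).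
    rewrite powS; apply: (posM_nneg cP J1) => //; apply: (nnegJ J1) => //.
    by apply: pow_nneg => //; apply: pos_nneg.
  (* If a were not moved upwards, then c, which has a power equal to a power of
     a modulo D, would not be moved upwards either. *)
  have [n_as|] := section_trichotomy cP J1 (subgroupV sC Caas); last by rewrite invgK.
  rewrite invgM invgK in n_as.
  have [m [n Dac]] := jump_commensurable J1 pa pc.
  have Dacs := DJ _ _ Es Dac; rewrite conjMg conjVg !conjXg in Dacs.
  have := pow_nneg _ _ m.+1 Ca n_as.
  have pcn := pow_pos n; rewrite !expVgn in pcn *.
  move=> /(nnegM cP J1)/(_ (lower_nneg J1 Dac)) /(nnegM_pos cP J1)/(_ pcn).
  move=> /(posM_nneg cP J1)/(_ (lower_nneg J1 (subgroupV sD Dacs))) [_ _ []].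
  by rewrite !gnorm; apply: (subgroup1 sD).
have flip s b : E s -> section_pos P C D b -> ~ section_pos P C D (b ^ s) ->
    forall c, section_pos P C D c -> P (c^-1 ^ s).
  move=> Es pb nbs c pc.
  have Ccs : C (c ^ s) by apply: (jump_normal J2) => //; case: pc.
  have nDcs : ~ D (c ^ s).
    by move=> /(DJ _ _ (subgroupV sE Es)); rewrite conjgK; case: pc.
  have [pcs|] := pos_or_inv J1 Ccs nDcs; last by rewrite conjVg; case.
  by case: nbs; apply: (preserved_sign J1 J2 Es pc pb pcs).
have nCt : ~ C t by move=> Ct; apply/nat/(jump_pos J1).
have [pt|pt] := pos_or_inv J2 Et nCt.
  have pV := flip _ _ Et pa nat a pa.
  exists t; split=> // c pc; apply: contrapT => ncV.
  have pct : section_pos P C D (c ^ t^-1).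
    have Cct : C (c ^ t^-1).
      by apply: (jump_normal J2); [exact: (subgroupV sE)|case: pc].
    have nDct : ~ D (c ^ t^-1) by move=> /(DJ _ _ Et); rewrite conjgKV; case: pc.
    by have [//|] := pos_or_inv J1 Cct nDct; rewrite -conjVg => -[].
  by apply/nat/(preserved_sign J1 J2 Et pct pa); rewrite conjgKV.
by exists t^-1; split=> //; rewrite invgK; apply: flip nat.
Qed.

End Flips.

(** * Isolation *)

Section Isolation.
Variables (G : groupType) (e : nat -> set G) (P : set G).
Hypotheses (eP : enumerates e) (cP : is_cone P) (Pc : conradian P).
Implicit Types (C D E Q : set G) (x y z g c t : G).

Definition determined C := exists s : seq G, {in s, forall x, P x} /\
  forall Q, is_cone Q -> {in s, forall x, Q x} -> P `&` C `<=` Q.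

(** By rank one, a positive g of E \ C satisfies g^m = t^n c with c in C and
    positive m and n. *)
Lemma determined_jump E C t : is_jump P E C -> section_pos P E C t ->
  (forall Q c, is_cone Q -> Q t -> P `&` C `<=` Q -> C c -> Q (t * c)) ->
  determined C -> determined E.
Proof.
move=> J pt Qtc [s [Ps sdet]]; have [Pt _ _] := pt.
exists (t :: s); split=> [x|Q cQ Qs]; first by rewrite inE => /predU1P[->|/Ps].
have QPC : P `&` C `<=` Q by apply: sdet => // x xs; apply: Qs; rewrite inE xs orbT.
have Qt : Q t by apply: Qs; apply: mem_head.
move=> g [Pg Eg]; have [Cg|nCg] := pselect (C g); first exact: QPC.
have [m [n /(subgroupV (jump_lower J))]] := jump_commensurable eP cP J (And3 Pg Eg nCg) pt.
rewrite invgM invgK => /(Qtc _ _ cQ Qt QPC).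
move=> Qgm; apply: (cone_root cQ (n := m)).
have -> : g ^+ m.+1 = t ^+ n * (t * (t ^- n.+1 * g ^+ m.+1)).
  by rewrite !mulgA -expgSr mulgV mul1g.
case: n Qgm => [|n] Qgm; first by rewrite mul1g.
by apply: (coneM cQ) => //; apply: coneX.
Qed.

(** For f > 1 in C \ D the element t f^-1 t^-1 is positive and lies in C, so
    t f^-1 = (t f^-1 t^-1) t is positive for Q. *)
Lemma determined_flip E C D : is_jump P C D -> is_jump P E C ->
  determined C -> determined E.
Proof.
move=> J1 J2; have [t [pt flip]] := flip_exists eP cP J1 J2.
apply: (determined_jump J2 pt) => Q c cQ Qt QPC Cc.
have sC := jump_upper J1; have [_ Et _] := pt; have sE := jump_upper J2.
have neg f : section_pos P C D f -> Q (t * f^-1).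
  move=> pf; have -> : t * f^-1 = f^-1 ^ t^-1 * t by rewrite conjgE !gnorm.
  apply: (coneM cQ) => //; apply: QPC; split; first exact: flip.
  apply: (jump_normal J2); first exact: (subgroupV sE).
  by apply: (subgroupV sC); case: pf.
have [Dc|nDc] := pselect (D c).
  have [c0 pc0] : exists c0, section_pos P C D c0.
    have [c0 [Cc0 nDc0]] := jump_neq J1.
    by have [p|p] := pos_or_inv cP J1 Cc0 nDc0; [exists c0|exists c0^-1].
  have -> : t * c = t * c0^-1 * (c0 * c) by rewrite !gnorm.
  apply: (coneM cQ); first exact: neg.
  by apply: QPC; have [] := posM_nneg cP J1 pc0 (lower_nneg J1 Dc).
have [[Pc' _ _]|/neg] := pos_or_inv cP J1 Cc nDc; last by rewrite invgK.
by apply: (coneM cQ) => //; apply: QPC.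
Qed.

Lemma determined_trivial : determined [set 1].
Proof. by exists [::]; split=> // Q _ _ x [/[swap] -> /(coneN1 cP)]. Qed.

(** A smallest hull at which the claim fails would have a principal predecessor
    at which the claim holds. *)
Lemma conradian_determined : determined setT.
Proof.
suff all g : determined (hull P g).
  have vT : is_convex P setT by [].
  by have [g _ ->] := convex_principal eP cP vT.
apply: contrapT => nd.
have [|||h nh hmin] := @hull_extremum _ e P (fun X Y => Y `<=` X)
    [set g | ~ determined (hull P g)] eP cP.
- by move=> X Y Z XY YZ; apply: subset_trans XY.
- by move=> x y; apply: (convex_total cP); apply: hull_convex.
- by exists g.
have hull1 : hull P 1 = [set 1].
  apply/seteqP; split; last by move=> _ ->.
  exact: hull_sub (trivial_convex cP) _.
have h1 : h <> 1.
  by move=> h1; apply: nh; rewrite h1 hull1; apply: determined_trivial.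
have J2 := conradian_jump cP Pc h1.
have [k bk bE] := convex_principal eP cP (jump_lower J2).
have dk : determined (hull P k).
  apply: contrapT => /hmin; rewrite -bE => /(_ h (hull_id _ _)) [_].
  by apply; apply: hull_id.
apply: nh; have [k1|/eqP k1] := eqVneq k 1; last first.
  move: J2; rewrite bE => J2; apply: determined_flip J2 dk.
  exact: conradian_jump.
move: J2; rewrite bE k1 hull1 => J2.
have [t [Et nCt]] := jump_neq J2.
have [t' pt] : exists t', section_pos P (hull P h) [set 1] t'.
  by have [p|p] := pos_or_inv cP J2 Et nCt; [exists t|exists t^-1].
apply: (determined_jump J2 pt) determined_trivial => Q c cQ Qt _ ->.
by rewrite mulg1.
Qed.

End Isolation.

Theorem theorem1p3 (G : groupType) :
  ~ (left_orders G #= [set: nat]%classic)%card.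
Proof.
move=> oN; have [e eP] := cones_enumerated oN.
have [P [[cP dP] per]] := limit_cone_periodic eP (cones_infinite oN).
have [s [Ps sdet]] := conradian_determined eP cP (periodic_conradian cP per).
have [R [cR RP sR]] := dP s.
apply: RP; apply/esym/(cone_eq cP cR) => x Px; apply: (sdet R) => //.
by move=> y ys; rewrite -sR //; apply: Ps.
Qed.
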